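(* Let $X$ be an orbifold stratified $G$-space with stratification $\{pt\}=X_1\subseteq X_2\subseteq\cdots\subseteq X_\ell=X$ and associated simple orbifold $G$-bundles $\xi^{A_j}\colon V_j/A_j\to B_j$, satisfying the following assumptions. (A1) For $j=2,\dots,\ell$ the simple orbifold bundles $\xi^{A_j}$ are $E$-orientable and have decompositions $$(\xi^{A_j}\colon V_j/A_j\to B_j)\cong\bigoplus_{s<j}(\xi^{A_{j,s}}\colon V_{j,s}/A_{j,s}\to B_j)$$ into simple orbifold bundles $\xi^{A_{j,s}}$ (some $V_{j,s}$ possibly trivial), inherited from a decomposition $V_j\cong\bigoplus_{s<j}V_{j,s}$ of vector bundles over $B_j$, where $A_{j,s}$ is the quotient of $A_j$ by the non-effective kernel of its action on $V_{j,s}$. (A2) For each $s<j$ there is a $G$-equivariant map $f_{j,s}\colon B_j\to B_s$ such that the restriction of the attaching map $\phi_j\colon S(V_j/A_j)\to X_{j-1}$ to $S(V_{j,s}/A_{j,s})$ satisfies $\phi_j|_{S(V_{j,s}/A_{j,s})}=f_{j,s}\circ\xi^{A_{j,s}}$, where $B_s$ is identified with its image in $X_{j-1}$. (A3) The equivariant Euler classes $e_G(\xi^{A_{j,s}})$, $s<j$, are not zero divisors and are pairwise relatively prime in $E_G^\ast(B_j)$. Then the image of the map $\iota^\ast\colon E_G^\ast(X)\to\prod_{j}E_G^\ast(B_j)$ induced by the inclusion $\iota\colon\bigsqcup_j B_j\hookrightarrow X$ is $$\Gamma_X:=\Big\{(x_j)\in\prod_{1\le j\le\ell}E_G^\ast(B_j)\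 \Big|\ e_G(\xi^{A_{j,s}})\ \text{divides}\ x_j-f_{j,s}^\ast(x_s)\ \text{for all}\ s<j\Big\}.$$
   Context: $G$ is a topological group; a $G$-space means a finite $G$-CW complex. $E_G^\ast$ is a complex-oriented $G$-equivariant cohomology theory associated to a ring $G$-spectrum $E$, and $E_G^\ast(X)$ denotes $E_G^\ast(X)\otimes_{\mathbb{Z}}\mathbb{Q}$ throughout; the cohomology of a Thom space is reduced cohomology. Simple orbifold $G$-bundle: let $\xi\colon V\to B$ be a complex $E$-orientable $G$-vector bundle and $A$ a finite group acting linearly on each fiber of $\xi$, commuting with the $G$-action on $V$ and preserving the $E$-orientation of $\xi$. The induced bundle $\xi^A\colon V/A\to B$ is a simple orbifold $G$-bundle. Put $D(V/A)=D(V)/A$, $S(V/A)=S(V)/A$ (with $A$-invariant disc and sphere bundles), $\mathrm{Th}(V/A)=D(V/A)/S(V/A)$. Standing assumption on $E_G^\ast$: for every simple orbifold $G$-bundle of (real) rank $n$ over a space $B$ there is an equivariant Thom class $\eta_A\in E_G^{\ast}(\mathrm{Th}(V/A))$ such that cup product with $\eta_A$ is an isomorphism $E_G^\ast(B)\cong E_G^{\ast+n}(\mathrm{Th}(V/A))$. The equivariant Euler class $e_G(\xi^A)\in E_G^\ast(B)$ is the restriction of $\eta_A$ to the zero section. Orbifold stratified $G$-space: a $G$-space $X$ with a $G$-equivariant stratification $\{pt\}=X_1\subseteq X_2\subseteq\cdots\subseteq X_\ell=X$ such that each successive quotient $X_j/X_{j-1}$ is homeomorphic to the Thom space $\mathrm{Th}(V_j/A_j)$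 of a simple orbifold $G$-bundle $\xi^{A_j}\colon V_j/A_j\to B_j$, and $X_j- X_{j-1}$ carries an effective orbifold structure. Thus $X_j$ is obtained from $X_{j-1}$ by attaching $D(V_j/A_j)$ along a $G$-equivariant map $\phi_j\colon S(V_j/A_j)\to X_{j-1}$ for $j=2,\dots,\ell$. Here $B_1=X_1$ is a point, and $B_j$ is included in $X$ as the zero section of $D(V_j/A_j)$. *)

(* Defs.v *)
From HB Require Import structures.
From mathcomp Require Import all_boot all_order all_algebra all_fingroup.
From mathcomp Require Import complex.
From mathcomp Require Import all_classical all_reals all_analysis.

Set Implicit Arguments.
Unset Strict Implicit.
Unset Printing Implicit Defensive.
#[local] Obligation Tactic := idtac.

Import Order.TTheory GRing.Theory Num.Theory numFieldNormedType.Exports.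

Local Open Scope classical_set_scope.
Local Open Scope ring_scope.
Local Open Scope quotient_scope.

(* R[i] carries its topology only through the numFieldType structure. *)
Definition Cplx (R : realType) : numClosedFieldType := R[i]%C.

HB.mixin Record isTopGroup G of Topological G & monoid.Group G := {
  mulg_continuous : continuous (fun x : G * G => (x.1 * x.2)%g);
  invg_continuous : continuous (fun x : G => (x^-1)%g) }.

#[short(type="topGroupType")]
HB.structure Definition TopGroup :=
  {G of Topological G & monoid.Group G & isTopGroup G}.

Section GSpaces.
Context {G : topGroupType}.

Record gspace := GSpace {
  gsp :> topologicalType;
  gact : G -> gsp -> gsp;
  gact1 : forall x, gact 1%g x = x;
  gactM : forall g h x, gact (g * h)%g x = gact g (gact h x);
  gact_continuous : continuous (fun gx : G * gsp => gact gx.1 gx.2) }.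

Record gmap (X Y : gspace) := GMap {
  gfun :> X -> Y;
  gfun_continuous : continuous gfun;
  gfun_equivariant : forall g x, gfun (gact g x) = gact g (gfun x) }.

Program Definition gid (X : gspace) : gmap X X := @GMap X X id _ _.
Next Obligation. by move=> X x; apply: cvg_id. Qed.
Next Obligation. by []. Qed.

Program Definition gcomp (X Y Z : gspace) (f : gmap Y Z) (h : gmap X Y) :
  gmap X Z := @GMap X Z (f \o h) _ _.
Next Obligation.
by move=> X Y Z f h x; apply: continuous_comp; exact: gfun_continuous.
Qed.
Next Obligation. by move=> X Y Z f h g x /=; rewrite !gfun_equivariant. Qed.

Record iset (X : gspace) := ISet {
  iset_set :> set X;
  iset_inv : forall g x, iset_set x -> iset_set (gact g x) }.

Program Definition iset0 (X : gspace) : iset X := @ISet X set0 _.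
Next Obligation. by []. Qed.

Program Definition isetI_pre (X Y : gspace) (f : gmap X Y) (B : iset Y) :
  iset X := @ISet X (f @^-1` B) _.
Next Obligation.
by move=> X Y f B g x /=; rewrite gfun_equivariant; exact: iset_inv.
Qed.

Program Definition iset_image (X Y : gspace) (f : gmap X Y) (A : iset X) :
  iset Y := @ISet Y (f @` A) _.
Next Obligation.
move=> X Y f A g _ [x Ax <-]; exists (gact g x); first exact: iset_inv.
by rewrite gfun_equivariant.
Qed.

Section Subspace.
Variables (X : gspace) (A : iset X).

Definition gsub_act (g : G) (x : set_type A) : set_type A :=
  exist _ (gact g (set_val x)) (mem_set (iset_inv g (set_valP x))).

Lemma gsub_act1 x : gsub_act 1%g x = x.
Proof. by apply: val_inj; rewrite /= gact1. Qed.

Lemma gsub_actM g h x : gsub_act (g * h)%g x = gsub_act g (gsub_act h x).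
Proof. by apply: val_inj; rewrite /= gactM. Qed.

Lemma continuous_into_sub (T : topologicalType) (f : T -> set_type A) :
  continuous (set_val \o f) -> continuous f.
Proof.
move=> cf; apply/continuousP => U [V oV <-].
by move/continuousP: cf => /(_ _ oV).
Qed.

Lemma set_val_continuous : continuous (set_val : set_type A -> X).
Proof. exact: initial_continuous. Qed.

Lemma gsub_act_continuous :
  continuous (fun gx : G * set_type A => gsub_act gx.1 gx.2).
Proof.
apply: continuous_into_sub => -[g x].
apply: (@continuous_comp _ _ _
  (fun gx : G * set_type A => (gx.1, set_val gx.2))
  (fun gx : G * X => gact gx.1 gx.2)); last exact: gact_continuous.
apply: cvg_pair; first exact: cvg_fst.
by apply: cvg_comp; [exact: cvg_snd|exact: set_val_continuous].
Qed.

Definition gsub : gspace :=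
  @GSpace (set_type A) gsub_act gsub_act1 gsub_actM gsub_act_continuous.

Program Definition gsub_incl : gmap gsub X := @GMap gsub X set_val _ _.
Next Obligation. exact: set_val_continuous. Qed.
Next Obligation. by []. Qed.

Program Definition gcorestrict (Y : gspace) (f : gmap Y X)
  (h : forall y, iset_set A (f y)) : gmap Y gsub :=
  @GMap Y gsub (fun y => exist _ (f y) (mem_set (h y))) _ _.
Next Obligation.
by move=> Y f h; apply: continuous_into_sub; exact: gfun_continuous.
Qed.
Next Obligation.
by move=> Y f h g y; apply: val_inj; rewrite /= gfun_equivariant.
Qed.

End Subspace.

Program Definition grestrict (X Y : gspace) (f : gmap X Y) (A : iset X)
  (B : iset Y) (h : forall x, iset_set A x -> iset_set B (f x)) : gmap (gsub A) (gsub B) :=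
  @gcorestrict Y B (gsub A) (gcomp f (gsub_incl A)) _.
Next Obligation. by move=> X Y f A B h x; exact: (h _ (set_valP (x : set_type A))). Qed.

Record gpair := GPair { psp : gspace; psub : iset psp }.

Record pmap (P Q : gpair) := PMap {
  pfun :> gmap (psp P) (psp Q);
  pfun_sub : forall x, iset_set (psub P) x -> iset_set (psub Q) (pfun x) }.

Program Definition pid (P : gpair) : pmap P P := @PMap P P (gid _) _.
Next Obligation. by []. Qed.

Program Definition pcomp (P Q S : gpair) (f : pmap Q S) (h : pmap P Q) :
  pmap P S := @PMap P S (gcomp f h) _.
Next Obligation. by move=> P Q S f h x Px; do 2!apply: pfun_sub. Qed.

Definition abs (X : gspace) : gpair := GPair (iset0 X).

Program Definition from_abs (X : gspace) (Q : gpair) (f : gmap X (psp Q)) :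
  pmap (abs X) Q := @PMap (abs X) Q f _.
Next Obligation. by []. Qed.

Definition abs_map (X Y : gspace) (f : gmap X Y) : pmap (abs X) (abs Y) :=
  @from_abs X (abs Y) f.

Definition rel_map (P : gpair) : pmap (abs (psp P)) P :=
  @from_abs (psp P) P (gid (psp P)).

Definition sub_map (P : gpair) : pmap (abs (gsub (psub P))) (abs (psp P)) :=
  abs_map (gsub_incl (psub P)).

Definition pmap_sub (P Q : gpair) (f : pmap P Q) :
  pmap (abs (gsub (psub P))) (abs (gsub (psub Q))) :=
  abs_map (grestrict (@pfun_sub P Q f)).

(* (A, A `&` B) -> (X, B) *)
Program Definition excision_map (X : gspace) (A B : iset X) :
  pmap (@GPair (gsub A) (isetI_pre (gsub_incl A) B)) (@GPair X B) :=
  @PMap (@GPair (gsub A) (isetI_pre (gsub_incl A) B)) (@GPair X B)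
    (gsub_incl A) _.
Next Obligation. by []. Qed.

(* A `|` B is covered by the interiors of A and B relative to A `|` B *)
Definition excisive (X : topologicalType) (A B : set X) : Prop :=
  forall x, (A `|` B) x ->
    (\forall y \near x, B y -> A y) \/ (\forall y \near x, A y -> B y).

Lemma excisive0 (X : topologicalType) (A : set X) : excisive set0 A.
Proof. by move=> x _; right; apply: nearW. Qed.

End GSpaces.

Arguments gspace : clear implicits.
Arguments gpair : clear implicits.

Definition homotopic (R : realType) (G : topGroupType) (P Q : gpair G)
    (f h : pmap P Q) : Prop :=
  exists H : R * psp P -> psp Q,
    [/\ {within [set t : R | 0 <= t <= 1] `*` setT, continuous H},
        forall x, H (0, x) = f x,
        forall x, H (1, x) = h x,
        forall t x g, 0 <= t <= 1 -> H (t, gact g x) = gact g (H (t, x))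
      & forall t x, 0 <= t <= 1 ->
        iset_set (psub P) x -> iset_set (psub Q) (H (t, x))].

Section GCW.
Variables (R : realType) (G : topGroupType).

Definition sqnorm n (x : 'rV[R]_n) : R := \sum_(i < n) x 0 i ^+ 2.

(* [cw_sk n] is the skeleton of dimension n - 1. The cell i of dimension n is
   G/H x D^n with H = [cw_stab i]; its characteristic map is given on
   G x D^n, from which G/H x D^n inherits the quotient topology. *)
Record gcw_structure (X : gspace G) := GCW {
  cw_sk : nat -> set X;
  cw_cells : nat -> nat;
  cw_stab : forall n, 'I_(cw_cells n) -> set G;
  cw_char : forall n, 'I_(cw_cells n) -> G * 'rV[R]_n -> X;
  cw_stab1 : forall n (i : 'I_(cw_cells n)), cw_stab i 1%g;
  cw_stabM : forall n (i : 'I_(cw_cells n)) g h,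
    cw_stab i g -> cw_stab i h -> cw_stab i (g * h)%g;
  cw_stabV : forall n (i : 'I_(cw_cells n)) g,
    cw_stab i g -> cw_stab i (g^-1)%g;
  cw_stab_closed : forall n (i : 'I_(cw_cells n)), closed (cw_stab i);
  cw_sk0 : cw_sk 0 = set0;
  cw_finite : exists N, cw_sk N = setT /\
    forall n, (N <= n)%N -> cw_cells n = 0%N;
  cw_sk_closed : forall n, closed (cw_sk n);
  cw_char_continuous : forall n (i : 'I_(cw_cells n)),
    {within setT `*` [set x | sqnorm x <= 1], continuous (cw_char i)};
  cw_char_equivariant : forall n (i : 'I_(cw_cells n)) g h x,
    sqnorm x <= 1 -> cw_char i ((g * h)%g, x) = gact g (cw_char i (h, x));
  cw_char_stab : forall n (i : 'I_(cw_cells n)) g h x,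
    sqnorm x <= 1 -> cw_stab i h -> cw_char i ((g * h)%g, x) = cw_char i (g, x);
  cw_char_boundary : forall n (i : 'I_(cw_cells n)) g x,
    sqnorm x = 1 -> cw_sk n (cw_char i (g, x));
  cw_char_interior : forall n (i : 'I_(cw_cells n)) g x,
    sqnorm x < 1 -> ~ cw_sk n (cw_char i (g, x));
  cw_char_inj : forall n (i i' : 'I_(cw_cells n)) g g' x x',
    sqnorm x < 1 -> sqnorm x' < 1 -> cw_char i (g, x) = cw_char i' (g', x') ->
    [/\ i = i', x = x' & cw_stab i (g^-1 * g')%g];
  cw_skS : forall n, cw_sk n.+1 = cw_sk n `|`
    \bigcup_(i : 'I_(cw_cells n)) (cw_char i @` (setT `*` [set x | sqnorm x <= 1]));
  cw_topology : forall n (Z : set X), Z `<=` cw_sk n.+1 ->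
    closed (Z `&` cw_sk n) ->
    (forall i : 'I_(cw_cells n),
       closed ((setT `*` [set x | sqnorm x <= 1]) `&` cw_char i @^-1` Z)) ->
    closed Z }.

Definition finite_gcw (X : gspace G) : Prop := inhabited (gcw_structure X).

End GCW.

Section Cohomology.
Variables (R : realType) (G : topGroupType).

(* The Eilenberg-Steenrod properties, together with the multiplicative
   structure, of the rationalised theory X |-> E_G^*(X) (x) Q represented by a
   ring G-spectrum E.  Being represented, the theory is defined on all pairs of
   G-spaces and not only on finite G-CW pairs.  [coh P] is the total group E_G^*(X, A) (x) Q, the
   direct sum of its homogeneous parts; [hcomp n] is the projection onto
   degree n. *)
Record cohomology_theory := CohomologyTheory {
  coh : gpair G -> lmodType rat;
  hcomp : forall P, int -> {linear coh P -> coh P};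
  hcomp_proj : forall P m n (x : coh P),
    hcomp P m (hcomp P n x) = if m == n then hcomp P n x else 0;
  hcomp_sum : forall P (x : coh P),
    exists2 s : seq int, uniq s & x = \sum_(n <- s) hcomp P n x;

  pull : forall P Q, pmap P Q -> {linear coh Q -> coh P};
  pull_id : forall P (x : coh P), pull (pid P) x = x;
  pull_comp : forall P Q S (f : pmap Q S) (h : pmap P Q) (x : coh S),
    pull (pcomp f h) x = pull h (pull f x);
  pull_hcomp : forall P Q (f : pmap P Q) n (x : coh Q),
    pull f (hcomp Q n x) = hcomp P n (pull f x);
  pull_homotopic : forall P Q (f h : pmap P Q) (x : coh Q),
    homotopic R f h -> pull f x = pull h x;

  delta : forall P, {linear coh (abs (gsub (psub P))) -> coh P};
  delta_hcomp : forall P n (x : coh (abs (gsub (psub P)))),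
    delta P (hcomp _ n x) = hcomp P (n + 1) (delta P x);
  delta_natural : forall P Q (f : pmap P Q) (x : coh (abs (gsub (psub Q)))),
    pull f (delta Q x) = delta P (pull (pmap_sub f) x);
  exact_space : forall P,
    [set x | pull (sub_map P) x = 0] = range (pull (rel_map P));
  exact_sub : forall P,
    [set x | delta P x = 0] = range (pull (sub_map P));
  exact_pair : forall P,
    [set x | pull (rel_map P) x = 0] = range (delta P);
  excision : forall (X : gspace G) (A B : iset X),
    A `|` B = setT -> excisive A B -> bijective (pull (excision_map A B));

  cup : forall (X : gspace G) (A B C : iset X),
    excisive A B -> (C : set X) = A `|` B ->
    coh (GPair A) -> coh (GPair B) -> coh (GPair C);
  cup_linear_l : forall (X : gspace G) (A B C : iset X)
      (e : excisive A B) (u : (C : set X) = A `|` B) k x x' y,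
    cup e u (k *: x + x') y = k *: cup e u x y + cup e u x' y;
  cup_linear_r : forall (X : gspace G) (A B C : iset X)
      (e : excisive A B) (u : (C : set X) = A `|` B) k x y y',
    cup e u x (k *: y + y') = k *: cup e u x y + cup e u x y';
  cup_degree : forall (X : gspace G) (A B C : iset X)
      (e : excisive A B) (u : (C : set X) = A `|` B) m n x y,
    cup e u (hcomp _ m x) (hcomp _ n y) =
    hcomp _ (m + n) (cup e u (hcomp _ m x) (hcomp _ n y));
  cup_natural : forall (X Y : gspace G) (A B C : iset X) (A' B' C' : iset Y)
      (e : excisive A B) (u : (C : set X) = A `|` B)
      (e' : excisive A' B') (u' : (C' : set Y) = A' `|` B')
      (fA : pmap (GPair A) (GPair A')) (fB : pmap (GPair B) (GPair B'))
      (fC : pmap (GPair C) (GPair C')) x y,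
    (fA : X -> Y) =1 fC -> (fB : X -> Y) =1 fC ->
    pull fC (cup e' u' x y) = cup e u (pull fA x) (pull fB y);
  cupA : forall (X : gspace G) (A B C AB BC D : iset X)
      (e1 : excisive A B) (u1 : (AB : set X) = A `|` B)
      (e2 : excisive AB C) (u2 : (D : set X) = AB `|` C)
      (e3 : excisive B C) (u3 : (BC : set X) = B `|` C)
      (e4 : excisive A BC) (u4 : (D : set X) = A `|` BC) x y z,
    cup e2 u2 (cup e1 u1 x y) z = cup e4 u4 x (cup e3 u3 y z);
  cupC : forall (X : gspace G) (A B C : iset X)
      (e : excisive A B) (u : (C : set X) = A `|` B)
      (e' : excisive B A) (u' : (C : set X) = B `|` A) m n x y,
    cup e u (hcomp _ m x) (hcomp _ n y) =
    ((-1) ^+ `|(m * n)%R|%N) *: cup e' u' (hcomp _ n y) (hcomp _ m x);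
  coh1 : forall X : gspace G, coh (abs X);
  coh1_degree : forall X : gspace G, hcomp _ 0 (coh1 X) = coh1 X;
  pull_coh1 : forall (X Y : gspace G) (f : gmap X Y),
    pull (abs_map f) (coh1 Y) = coh1 X;
  cup1 : forall (X : gspace G) (A : iset X) (e : excisive (iset0 X) A)
      (u : (A : set X) = iset0 X `|` A) x,
    cup e u (coh1 X) x = x;
  cup_delta : forall (X : gspace G) (A : iset X)
      (e : excisive A (iset0 X)) (u : (A : set X) = A `|` iset0 X)
      (e' : excisive (iset0 (gsub A)) (iset0 (gsub A)))
      (u' : (iset0 (gsub A) : set _) = iset0 (gsub A) `|` iset0 (gsub A))
      (a : coh (abs (gsub A))) (x : coh (abs X)),
    delta (GPair A) (cup e' u' a (pull (sub_map (GPair A)) x)) =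
    cup e u (delta (GPair A) a) x }.

Variable E : cohomology_theory.

Definition homogeneous (P : gpair G) (n : int) (x : coh E P) : Prop :=
  hcomp E P n x = x.

Definition gpull (X Y : gspace G) (f : gmap X Y) :
  coh E (abs Y) -> coh E (abs X) := pull E (abs_map f).

Definition cupm (X : gspace G) (A : iset X) (x : coh E (abs X))
    (y : coh E (GPair A)) : coh E (GPair A) :=
  @cup E X (iset0 X) A A (@excisive0 X A) (esym (set0U A)) x y.

Definition cupr (X : gspace G) (x y : coh E (abs X)) : coh E (abs X) :=
  cupm x y.

Definition cdivides (X : gspace G) (e x : coh E (abs X)) : Prop :=
  exists c, x = cupr e c.

Definition nonzerodivisor (X : gspace G) (e : coh E (abs X)) : Prop :=
  forall x, cupr e x = 0 \/ cupr x e = 0 -> x = 0.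

(* (e) `&` (e') = (e e'): in a unique factorisation domain this says that e
   and e' have no common prime factor, but E_G^*(X) need not be one. *)
Definition relatively_prime (X : gspace G) (e e' : coh E (abs X)) : Prop :=
  forall x, cdivides e x -> cdivides e' x -> cdivides (cupr e e') x.

Definition thom_class (B X : gspace G) (A : iset X) (p : gmap X B) (n : nat)
    (eta : coh E (GPair A)) : Prop :=
  homogeneous n%:Z eta /\
  bijective (fun x : coh E (abs B) => cupm (gpull p x) eta).

End Cohomology.

Arguments hcomp {R G} _ _ _.
Arguments pull {R G} _ {P Q} _.

Section VectorBundles.
Variables (R : realType) (G : topGroupType).

Record cvbundle (B : gspace G) := CVBundle {
  vb_total :> gspace G;
  vb_proj : gmap vb_total B;
  vb_zero : gmap B vb_total;
  vb_rank : nat;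
  vb_add : vb_total -> vb_total -> vb_total;
  vb_scale : Cplx R -> vb_total -> vb_total;
  vb_ip : vb_total -> vb_total -> Cplx R;
  vb_trivial : forall b : B,
    exists (U : set B) (t : B * 'rV[Cplx R]_vb_rank -> vb_total)
           (s : vb_total -> 'rV[Cplx R]_vb_rank),
    [/\ open_nbhs b U,
        {within U `*` setT, continuous t},
        {within vb_proj @^-1` U, continuous s},
        (forall v, U (vb_proj v) -> t (vb_proj v, s v) = v)
      & forall u, U u ->
        [/\ forall x, vb_proj (t (u, x)) = u,
            forall x, s (t (u, x)) = x,
            forall x y, t (u, x + y) = vb_add (t (u, x)) (t (u, y)),
            forall c x, t (u, c *: x) = vb_scale c (t (u, x))
          & t (u, 0) = vb_zero u]];
  vb_act_add : forall g v w, vb_proj v = vb_proj w ->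
    gact g (vb_add v w) = vb_add (gact g v) (gact g w);
  vb_act_scale : forall g c v, gact g (vb_scale c v) = vb_scale c (gact g v);
  vb_ip_continuous : {within [set vw | vb_proj vw.1 = vb_proj vw.2],
    continuous (fun vw : vb_total * vb_total => vb_ip vw.1 vw.2)};
  vb_ip_add : forall v v' w, vb_proj v = vb_proj w -> vb_proj v' = vb_proj w ->
    vb_ip (vb_add v v') w = vb_ip v w + vb_ip v' w;
  vb_ip_scale : forall c v w, vb_proj v = vb_proj w ->
    vb_ip (vb_scale c v) w = c * vb_ip v w;
  vb_ip_conj : forall v w, vb_proj v = vb_proj w ->
    vb_ip w v = Num.conj (vb_ip v w);
  vb_ip_pos : forall v, v <> vb_zero (vb_proj v) -> 0 < vb_ip v v;
  vb_act_ip : forall g v w, vb_proj v = vb_proj w ->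
    vb_ip (gact g v) (gact g w) = vb_ip v w }.

Section Discs.
Variables (B : gspace G) (V : cvbundle B).

Program Definition vb_disc : iset V :=
  @ISet G V [set v | vb_ip v v <= 1] _.
Next Obligation. by move=> g v /=; rewrite vb_act_ip. Qed.

Program Definition vb_sphere : iset V :=
  @ISet G V [set v | vb_ip v v = 1] _.
Next Obligation. by move=> g v /=; rewrite vb_act_ip. Qed.

Definition disc_pair : gpair G :=
  @GPair G (gsub vb_disc) (isetI_pre (gsub_incl vb_disc) vb_sphere).

Definition disc_proj : gmap (psp disc_pair) B :=
  gcomp (vb_proj V) (gsub_incl vb_disc).

End Discs.

Definition isometric (B B' : gspace G) (V : cvbundle B) (V' : cvbundle B')
    (F : V -> V') : Prop :=
  forall v, vb_ip (F v) (F v) = vb_ip v v.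

Program Definition disc_map (B B' : gspace G) (V : cvbundle B)
    (V' : cvbundle B') (F : gmap V V') (h : isometric F) :
    pmap (disc_pair V) (disc_pair V') :=
  @PMap G (disc_pair V) (disc_pair V')
    (@grestrict G _ _ F (vb_disc V) (vb_disc V') _) _.
Next Obligation. by move=> B B' V V' F h v /=; rewrite h. Qed.
Next Obligation. by move=> B B' V V' F h v /=; rewrite h. Qed.

Definition bundle_map (B B' : gspace G) (V : cvbundle B) (V' : cvbundle B')
    (f : B -> B') (F : V -> V') : Prop :=
  [/\ forall v, vb_proj V' (F v) = f (vb_proj V v),
      forall v w, vb_proj V v = vb_proj V w ->
        F (vb_add v w) = vb_add (F v) (F w)
    & forall c v, F (vb_scale c v) = vb_scale c (F v)].

Record complex_orientation (E : cohomology_theory R G) := ComplexOrientation {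
  co_class : forall B (V : cvbundle B), coh E (disc_pair V);
  co_thom : forall B (V : cvbundle B), finite_gcw R B ->
    thom_class (@disc_proj B V) (vb_rank V).*2 (co_class V);
  co_natural : forall B B' (V : cvbundle B) (V' : cvbundle B')
      (f : gmap B B') (F : gmap V V') (h : isometric F),
    finite_gcw R B -> finite_gcw R B' ->
    vb_rank V = vb_rank V' -> bundle_map f F ->
    pull E (disc_map h) (co_class V') = co_class V }.

End VectorBundles.

Section OrbifoldBundles.
Variables (R : realType) (G : topGroupType).

Record linear_action (B : gspace G) (V : cvbundle R B) := LinearAction {
  la_group : finGroupType;
  la_map : la_group -> gmap V V;
  la1 : forall v, la_map 1%g v = v;
  laM : forall a b v, la_map (a * b)%g v = la_map a (la_map b v);
  la_linear : forall a, bundle_map id (la_map a);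
  la_isometric : forall a, isometric (la_map a) }.

Arguments la_map {B V} _ _.
Arguments la_linear {B V} _ _.
Arguments la_isometric {B V} _ _ _.

Section OrbitSpace.
Variables (B : gspace G) (V : cvbundle R B) (A : linear_action V).

Definition orbit_rel (v w : V) : bool := `[< exists a, w = la_map A a v >].

Lemma orbit_rel_refl : reflexive orbit_rel.
Proof. by move=> v; apply/asboolP; exists 1%g; rewrite la1. Qed.

Lemma orbit_rel_sym : symmetric orbit_rel.
Proof.
have H v w : orbit_rel v w -> orbit_rel w v.
  move=> /asboolP[a ->]; apply/asboolP; exists (a^-1)%g.
  by rewrite -laM mulVg la1.
by move=> v w; apply/idP/idP; exact: H.
Qed.

Lemma orbit_rel_trans : transitive orbit_rel.
Proof.
move=> w v x /asboolP[a ->] /asboolP[b ->]; apply/asboolP.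
by exists (b * a)%g; rewrite laM.
Qed.

Definition orbit_equiv : equiv_rel V :=
  EquivRel orbit_rel orbit_rel_refl orbit_rel_sym orbit_rel_trans.

Definition orbit_space : topologicalType :=
  quotient_topology {eq_quot orbit_equiv}.

Definition orbit_fun (v : V) : orbit_space := \pi_{eq_quot orbit_equiv} v.

Definition orbit_repr (q : orbit_space) : V :=
  generic_quotient.repr (q : {eq_quot orbit_equiv}).

Lemma orbit_funP v w :
  orbit_fun v = orbit_fun w <-> exists a, w = la_map A a v.
Proof.
split=> [/eqquotP/asboolP //|h].
by apply/eqquotP; exact/asboolP.
Qed.

Lemma orbit_fun_repr q : orbit_fun (orbit_repr q) = q.
Proof. exact: reprK. Qed.

Lemma orbit_fun_continuous : continuous orbit_fun.
Proof. exact: pi_continuous. Qed.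

Lemma orbit_fun_open (U : set V) : open U -> open (orbit_fun @` U).
Proof.
move=> oU; change (open (orbit_fun @^-1` (orbit_fun @` U))).
have -> : orbit_fun @^-1` (orbit_fun @` U) = \bigcup_a (la_map A a @^-1` U).
  apply/seteqP; split => v /=.
    by move=> [w Uw /esym/orbit_funP[a e]]; exists a => //=; rewrite -e.
  move=> [a _ /= Uav]; exists (la_map A a v) => //.
  by apply/esym/orbit_funP; exists a.
apply: bigcup_open => a _.
by have /continuousP := @gfun_continuous _ _ _ (la_map A a); exact.
Qed.

Definition orbit_act (g : G) (q : orbit_space) : orbit_space :=
  orbit_fun (gact g (orbit_repr q)).

Lemma orbit_act_pi g v : orbit_act g (orbit_fun v) = orbit_fun (gact g v).
Proof.
apply/orbit_funP.
have /orbit_funP[a e] := orbit_fun_repr (orbit_fun v).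
by exists a; rewrite [in LHS]e gfun_equivariant.
Qed.

Lemma orbit_act1 q : orbit_act 1%g q = q.
Proof. by rewrite -[q]orbit_fun_repr orbit_act_pi gact1. Qed.

Lemma orbit_actM g h q : orbit_act (g * h)%g q = orbit_act g (orbit_act h q).
Proof. by rewrite -[q]orbit_fun_repr !orbit_act_pi gactM. Qed.

Lemma orbit_act_continuous :
  continuous (fun gq : G * orbit_space => orbit_act gq.1 gq.2).
Proof.
move=> [g q] U /=; rewrite -[q]orbit_fun_repr orbit_act_pi => nU.
set v := orbit_repr _ in nU *.
have /= := @gact_continuous _ V (g, v) (orbit_fun @^-1` U)
  (@orbit_fun_continuous _ _ nU).
move=> [[M N] [/= nM]]; rewrite nbhsE => -[N' [oN' N'v] sN'] sMN.
exists (M, orbit_fun @` N') => /=.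
  split=> //.
  apply: (@open_nbhs_nbhs orbit_space (orbit_fun v) (orbit_fun @` N')).
  by split; [exact: orbit_fun_open|exists v].
move=> [g' _] /= [Mg' [w N'w <-]]; rewrite orbit_act_pi.
by apply: (sMN (g', w)); split=> //=; exact: sN'.
Qed.

Definition orbit_gspace : gspace G :=
  @GSpace G orbit_space orbit_act orbit_act1 orbit_actM orbit_act_continuous.

Program Definition orbit_pi : gmap V orbit_gspace :=
  @GMap G V orbit_gspace orbit_fun _ _.
Next Obligation. exact: orbit_fun_continuous. Qed.
Next Obligation. by move=> g v; rewrite /= orbit_act_pi. Qed.

Lemma vb_proj_repr v :
  vb_proj V (orbit_repr (orbit_fun v)) = vb_proj V v.
Proof.
have /orbit_funP[a e] := orbit_fun_repr (orbit_fun v).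
by rewrite [in RHS]e; have [-> _ _] := la_linear A a.
Qed.

Program Definition orbit_proj : gmap orbit_gspace B :=
  @GMap G orbit_gspace B
    (fun q => vb_proj V (orbit_repr q)) _ _.
Next Obligation.
apply/continuousP => U oU; change (open (orbit_fun @^-1`
  ((fun q : orbit_space => vb_proj V (orbit_repr q)) @^-1` U))).
rewrite (_ : _ @^-1` _ = vb_proj V @^-1` U).
  by have /continuousP := @gfun_continuous _ _ _ (vb_proj V); exact.
by apply/seteqP; split => v /=; rewrite vb_proj_repr.
Qed.
Next Obligation. by move=> g q; rewrite /= vb_proj_repr gfun_equivariant. Qed.

Definition orbit_disc : iset orbit_gspace := iset_image orbit_pi (vb_disc V).
Definition orbit_sphere : iset orbit_gspace :=
  iset_image orbit_pi (vb_sphere V).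

Definition orbit_disc_pair : gpair G :=
  @GPair G (gsub orbit_disc) (isetI_pre (gsub_incl orbit_disc) orbit_sphere).

Definition orbit_disc_proj : gmap (psp orbit_disc_pair) B :=
  gcomp orbit_proj (gsub_incl orbit_disc).

Lemma vb_ip0 b : vb_ip (vb_zero V b) (vb_zero V b) = 0.
Proof.
have [U [t [s [[_ Ub] _ _ _ /(_ b Ub)[tp _ _ tZ t0]]]]] := vb_trivial V b.
by rewrite -t0 -[X in vb_ip (t (b, X))](scale0r 0) tZ vb_ip_scale // mul0r.
Qed.

Program Definition orbit_zero : gmap B (psp orbit_disc_pair) :=
  @gcorestrict G _ orbit_disc B (gcomp orbit_pi (vb_zero V)) _.
Next Obligation.
by move=> b; exists (vb_zero V b) => //=; rewrite vb_ip0 ler01.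
Qed.

End OrbitSpace.

Record sob (E : cohomology_theory R G) (B : gspace G) := SOB {
  sob_bundle :> cvbundle R B;
  sob_action : linear_action sob_bundle;
  sob_orientation : coh E (disc_pair sob_bundle);
  sob_orientationP :
    thom_class (disc_proj sob_bundle) (vb_rank sob_bundle).*2 sob_orientation;
  sob_orientation_inv : forall a : la_group sob_action,
    pull E (disc_map (la_isometric sob_action a)) sob_orientation =
    sob_orientation }.

Section Thom.
Variable E : cohomology_theory R G.

(* The reduced cohomology of Th(V/A) = D(V/A)/S(V/A) is E_G^*(D(V/A), S(V/A)). *)
Definition thom_pair (B : gspace G) (xi : sob E B) : gpair G :=
  orbit_disc_pair (sob_action xi).

Record thom_classes := ThomClasses {
  orb_thom : forall B (xi : sob E B), coh E (thom_pair xi);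
  orb_thomP : forall B (xi : sob E B), finite_gcw R B ->
    thom_class (orbit_disc_proj (sob_action xi)) (vb_rank xi).*2 (orb_thom xi) }.

Definition euler_class (eta : thom_classes) (B : gspace G) (xi : sob E B) :
    coh E (abs B) :=
  pull E (@from_abs G B (thom_pair xi) (orbit_zero (sob_action xi)))
    (orb_thom eta xi).

(* A decomposition of V/A over B into the W_s/A_s, inherited from a
   decomposition of V into the W_s. *)
Record decomposition (B : gspace G) (I : finType) (V : sob E B)
    (W : I -> sob E B) := Decomposition {
  dc_proj : forall s, gmap V (W s);
  dc_incl : forall s, gmap (W s) V;
  dc_proj_linear : forall s, bundle_map id (dc_proj s);
  dc_incl_linear : forall s, bundle_map id (dc_incl s);
  dc_incl_isometric : forall s, isometric (dc_incl s);
  dc_inclK : forall s w, dc_proj s (dc_incl s w) = w;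
  dc_incl_proj0 : forall s t w, t != s ->
    dc_proj t (dc_incl s w) = vb_zero (W t) (vb_proj (W s) w);
  dc_inj : forall v v' : V, vb_proj V v = vb_proj V v' ->
    (forall s, dc_proj s v = dc_proj s v') -> v = v';
  dc_surj : forall b (w : forall s, W s), (forall s, vb_proj (W s) (w s) = b) ->
    exists2 v : V, vb_proj V v = b & forall s, dc_proj s v = w s;
  (* A_s is the quotient of A by the kernel of its action on W_s *)
  dc_quot : forall s, la_group (sob_action V) -> la_group (sob_action (W s));
  dc_quotM : forall s a b, dc_quot s (a * b)%g = (dc_quot s a * dc_quot s b)%g;
  dc_quot_surj : forall s c, exists a, dc_quot s a = c;
  dc_quot_ker : forall s a, dc_quot s a = 1%g <->
    forall w, la_map (sob_action V) a (dc_incl s w) = dc_incl s w;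
  dc_quot_act : forall s a v, dc_proj s (la_map (sob_action V) a v) =
    la_map (sob_action (W s)) (dc_quot s a) (dc_proj s v);
  (* Injectivity of the induced map from V/A to the sum of the W_s/A_s; this
     map is always open, continuous and onto. *)
  dc_orbit_inj : forall v v' : V, vb_proj V v = vb_proj V v' ->
    (forall s, orbit_fun (sob_action (W s)) (dc_proj s v) =
               orbit_fun (sob_action (W s)) (dc_proj s v')) ->
    orbit_fun (sob_action V) v = orbit_fun (sob_action V) v' }.

End Thom.

End OrbifoldBundles.

Section Orbifolds.
Variable R : realType.

Fixpoint Ck k m n (U : set 'rV[R]_m) (f : 'rV[R]_m -> 'rV[R]_n) : Prop :=
  if k is k'.+1 then
    (forall x, U x -> differentiable f x) /\
    forall v, Ck k' U (fun x => 'D_v f x)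
  else forall x, U x -> {for x, continuous f}.

Definition smooth m n (U : set 'rV[R]_m) (f : 'rV[R]_m -> 'rV[R]_n) : Prop :=
  forall k, Ck k U f.

Record orbifold_chart (n : nat) (T : topologicalType) := OrbifoldChart {
  oc_dom : set 'rV[R]_n;
  oc_group : finGroupType;
  oc_act : oc_group -> 'rV[R]_n -> 'rV[R]_n;
  oc_map : 'rV[R]_n -> T;
  oc_open : open oc_dom;
  oc_connected : connected oc_dom;
  oc_act_dom : forall a x, oc_dom x -> oc_dom (oc_act a x);
  oc_act_smooth : forall a, smooth oc_dom (oc_act a);
  oc_act1 : forall x, oc_dom x -> oc_act 1%g x = x;
  oc_actM : forall a b x, oc_dom x ->
    oc_act (a * b)%g x = oc_act a (oc_act b x);
  oc_effective : forall a, (forall x, oc_dom x -> oc_act a x = x) -> a = 1%g;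
  oc_map_continuous : {within oc_dom, continuous oc_map};
  oc_map_orbit : forall x y, oc_dom x -> oc_dom y ->
    oc_map x = oc_map y <-> exists a, y = oc_act a x;
  oc_map_open : forall W, open W -> W `<=` oc_dom -> open (oc_map @` W) }.

Definition chart_embedding n (T : topologicalType) (c d : orbifold_chart n T) :
    Prop :=
  exists (f h : 'rV[R]_n -> 'rV[R]_n),
    [/\ smooth (oc_dom c) f, open (f @` oc_dom c), smooth (f @` oc_dom c) h &
        forall x, oc_dom c x ->
          [/\ oc_dom d (f x), h (f x) = x & oc_map d (f x) = oc_map c x]].

Definition paracompact (T : topologicalType) : Prop :=
  forall O : set (set T), (forall U, O U -> open U) ->
    \bigcup_(U in O) U = setT ->
  exists O' : set (set T),
    [/\ forall U, O' U -> open U /\ exists2 V, O V & U `<=` V,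
        \bigcup_(U in O') U = setT
      & forall x : T, exists2 N, nbhs x N &
          finite_set [set U | O' U /\ U `&` N !=set0]].

Definition effective_orbifold (T : topologicalType) : Prop :=
  [/\ hausdorff_space T, paracompact T &
  exists (n : nat) (I : Type) (c : I -> orbifold_chart n T),
    (forall x, exists i, (oc_map (c i) @` oc_dom (c i)) x) /\
    forall i j x, (oc_map (c i) @` oc_dom (c i)) x ->
      (oc_map (c j) @` oc_dom (c j)) x ->
      exists k, [/\ (oc_map (c k) @` oc_dom (c k)) x,
        chart_embedding (c k) (c i) & chart_embedding (c k) (c j)]].

End Orbifolds.

Section Stratified.
Variables (R : realType) (G : topGroupType) (E : cohomology_theory R G).

(* Y' is obtained from Y by attaching P along chi : S -> Y, and chi : P -> Y' is
   the characteristic map. *)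
Definition attached (X P : topologicalType) (Y Y' : set X) (S : set P)
    (chi : P -> X) : Prop :=
  [/\ closed Y, Y `<=` Y', chi @` S `<=` Y, set_bij (~` S) (Y' `\` Y) chi
    & forall Z, Z `<=` Y' -> closed (Z `&` Y) -> closed (chi @^-1` Z) ->
        closed Z].

Program Definition isetD (X : gspace G) (A B : iset X) : iset X :=
  @ISet G X (A `\` B) _.
Next Obligation.
move=> X A B g x [Ax nBx]; split; first exact: iset_inv.
by move=> /(iset_inv (g^-1)%g); rewrite -gactM mulVg gact1.
Qed.

(* [os_filt j] is X_j, with X_0 empty; the strata are indexed by j : 'I_l,
   where j stands for the stratum X_{j+1} - X_j.  For j = 0 the attaching
   condition says that X_1 is the disc bundle over B_1, so that B_1 is
   identified with the point X_1 and the bundle over it has rank 0. *)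
Record orbifold_stratification (X : gspace G) (l : nat) := OrbifoldStratification {
  os_filt : nat -> iset X;
  os_base : 'I_l -> gspace G;
  os_bundle : forall j, sob E (os_base j);
  os_char : forall j, gmap (psp (thom_pair (os_bundle j))) X;
  os_length : (0 < l)%N;
  os_filt0 : (os_filt 0 : set X) = set0;
  os_filt1 : exists x, (os_filt 1 : set X) = [set x];
  os_filt_last : (os_filt l : set X) = setT;
  os_base_gcw : forall j, finite_gcw R (os_base j);
  os_attached : forall j : 'I_l,
    attached (os_filt j) (os_filt j.+1) (psub (thom_pair (os_bundle j)))
      (os_char j);
  os_orbifold : forall j : 'I_l,
    effective_orbifold R (gsub (isetD (os_filt j.+1) (os_filt j))) }.

Definition os_incl (X : gspace G) l (K : orbifold_stratification X l)
    (j : 'I_l) : gmap (os_base K j) X :=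
  gcomp (os_char K j) (orbit_zero (sob_action (os_bundle K j))).

Definition below l (j : 'I_l) : finType := {s : 'I_l | (s < j)%N}.

Definition os_restriction (X : gspace G) l (K : orbifold_stratification X l)
    (y : coh E (abs X)) : forall j : 'I_l, coh E (abs (os_base K j)) :=
  fun j => gpull (os_incl K j) y.

(* chi o (the inclusion S(W_s/A_s) -> S(V/A)) = (the inclusion of B_s) o f o p;
   d is the point of D(V/A) represented by the image of w. *)
Definition attaches_along (X : gspace G) (B C : gspace G) (V W : sob E B)
    (chi : psp (thom_pair V) -> X) (i : W -> V) (f : B -> C) (incl : C -> X) :
    Prop :=
  forall (w : W) (d : set_type (orbit_disc (sob_action V))),
    vb_ip w w = 1 -> set_val d = orbit_fun (sob_action V) (i w) ->
    chi d = incl (f (vb_proj W w)).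

End Stratified.

(* Main.v *)
(* Write p : S(V/A) -> B for the projection. By exactness and the Thom
   isomorphism, a class a on B is divisible by the Euler class of V/A if and
   only if p^* a = 0. Applied to each V_{j,s}/A_{j,s}, this gives the
   congruences for the restriction of a class y on X: over S(V_{j,s}/A_{j,s})
   both x_j and f_{j,s}^*(x_s) pull back to the restriction of y.
   Conversely, a family (x_j) in Gamma_X is lifted stratum by stratum. S(V/A)
   is covered by the open sets where a given component is nonzero, and the
   Euler class of that component vanishes there, so the product of the Euler
   classes of the components vanishes on S(V/A); hence it is divisible by
   e(V/A), which is therefore regular. So the restriction E(D,S) -> E(D) is
   injective, the connecting map E(X_{j-1}) -> E(X_j, X_{j-1}) = E(D,S) is
   zero, and a class on X_{j-1} extends to X_j. The extension differs from
   x_j on B_j by a class divisible by all the Euler classes, hence by their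
   product by coprimality, hence by e(V/A), and thus by the restriction of a
   class in E(X_j, X_{j-1}). *)
From Pilot Require Import Defs.
From mathcomp Require Import all_boot all_order all_algebra all_fingroup.
From mathcomp Require Import complex.
From mathcomp Require Import all_classical all_reals all_analysis.
Import Pilot.Defs.

Set Implicit Arguments.
Unset Strict Implicit.
Unset Printing Implicit Defensive.

Import Order.TTheory GRing.Theory Num.Theory numFieldNormedType.Exports.

Local Open Scope classical_set_scope.
Local Open Scope ring_scope.

(** * Products and vanishing of cohomology classes *)

Section Maps.
Context {G : topGroupType}.

Lemma gmap_ext (X Y : gspace G) (f h : gmap X Y) : f =1 h -> f = h.
Proof.
case: f h => f cf ef [h ch eh] /= /funext fh.
by subst h; congr GMap; exact: Prop_irrelevance.
Qed.

Lemma pmap_ext (P Q : gpair G) (f h : pmap P Q) :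
  (f : psp P -> psp Q) =1 h -> f = h.
Proof.
case: f h => f sf [h sh] /= /gmap_ext fh.
by subst h; congr PMap; exact: Prop_irrelevance.
Qed.

Definition isetT (X : gspace G) : iset X := @ISet G X setT (fun _ _ _ => I).

Lemma isetU_inv (X : gspace G) (A B : iset X) g x :
  (A `|` B) x -> (A `|` B) (gact g x).
Proof. by case=> ?; [left|right]; exact: iset_inv. Qed.

Definition isetU (X : gspace G) (A B : iset X) : iset X :=
  ISet (@isetU_inv X A B).

Lemma excisive_open (X : topologicalType) (A B : set X) :
  open A -> open B -> excisive A B.
Proof.
move=> oA oB x [Ax|Bx]; [left|right].
  by have : nbhs x A by [exact: open_nbhs_nbhs]; apply: filterS.
by have : nbhs x B by [exact: open_nbhs_nbhs]; apply: filterS.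
Qed.

End Maps.

Section Cohomology.
Context {R : realType} {G : topGroupType} {E : cohomology_theory R G}.

Lemma pull_ext (P Q : gpair G) (f h : pmap P Q) (x : coh E Q) :
  (f : psp P -> psp Q) =1 h -> pull E f x = pull E h x.
Proof. by move=> /pmap_ext ->. Qed.

Lemma pull_comp_ext (P Q S : gpair G) (f : pmap Q S) (h : pmap P Q)
    (k : pmap P S) (x : coh E S) :
  (f \o h : psp P -> psp S) =1 k -> pull E h (pull E f x) = pull E k x.
Proof. by move=> fh; rewrite -pull_comp; exact: pull_ext. Qed.

Lemma pull_bij_inv (P Q : gpair G) (f : pmap P Q) (h : pmap Q P) :
  cancel f h -> cancel h f -> bijective (pull E f).
Proof.
move=> fK hK; exists (pull E h) => x;
  by rewrite (@pull_comp_ext _ _ _ _ _ (pid _)) ?pull_id.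
Qed.

Lemma gpull_comp_ext (X Y Z : gspace G) (f : gmap Y Z) (h : gmap X Y)
    (k : gmap X Z) (x : coh E (abs Z)) :
  f \o h =1 k -> gpull h (gpull f x) = gpull k x.
Proof. by move=> fh; apply: pull_comp_ext. Qed.

Lemma gpull_ext (X Y : gspace G) (f h : gmap X Y) (x : coh E (abs Y)) :
  f =1 h -> gpull f x = gpull h x.
Proof. by move=> /gmap_ext ->. Qed.

Lemma gpullB (X Y : gspace G) (f : gmap X Y) (x y : coh E (abs Y)) :
  gpull f (x - y) = gpull f x - gpull f y.
Proof. exact: raddfB. Qed.

Lemma gpullD (X Y : gspace G) (f : gmap X Y) (x y : coh E (abs Y)) :
  gpull f (x + y) = gpull f x + gpull f y.
Proof. exact: raddfD. Qed.

Lemma gpull0 (X Y : gspace G) (f : gmap X Y) :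
  gpull f (0 : coh E (abs Y)) = 0.
Proof. exact: raddf0. Qed.

Lemma pull_rel_sub (P : gpair G) (x : coh E P) :
  gpull (gsub_incl (psub P)) (pull E (rel_map P) x) = 0.
Proof.
have : range (pull E (rel_map P)) (pull E (rel_map P) x) by exists x.
by rewrite -exact_space.
Qed.

Lemma exact_spaceP (P : gpair G) (x : coh E (abs (psp P))) :
  gpull (gsub_incl (psub P)) x = 0 -> exists y, x = pull E (rel_map P) y.
Proof.
move=> x0; have : [set x | pull E (Defs.sub_map P) x = 0] x by [].
by rewrite exact_space => -[y _ <-]; exists y.
Qed.

Section Ring.
Variable X : gspace G.
Implicit Types x y z e : coh E (abs X).

Lemma cuprA x y z : cupr x (cupr y z) = cupr (cupr x y) z.
Proof. by symmetry; exact: cupA. Qed.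

Lemma cup1r x : cupr (coh1 E X) x = x.
Proof. exact: cup1. Qed.

Lemma cuprDl x x' y : cupr (x + x') y = cupr x y + cupr x' y.
Proof.
have := @cup_linear_l R G E X (iset0 X) (iset0 X) (iset0 X)
  (@excisive0 X (iset0 X)) (esym (set0U _)) 1 x x' y.
by rewrite !scale1r.
Qed.

Lemma cuprDr x y y' : cupr x (y + y') = cupr x y + cupr x y'.
Proof.
have := @cup_linear_r R G E X (iset0 X) (iset0 X) (iset0 X)
  (@excisive0 X (iset0 X)) (esym (set0U _)) 1 x y y'.
by rewrite !scale1r.
Qed.

Lemma cupr0 x : cupr x 0 = 0.
Proof. by apply: (@addrI _ (cupr x 0)); rewrite -cuprDr !addr0. Qed.

Lemma cup0r y : cupr 0 y = 0.
Proof. by apply: (@addrI _ (cupr 0 y)); rewrite -cuprDl !addr0. Qed.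

Lemma cuprNr x y : cupr x (- y) = - cupr x y.
Proof. by apply: (@addrI _ (cupr x y)); rewrite -cuprDr !subrr cupr0. Qed.

Lemma cuprBr x y y' : cupr x (y - y') = cupr x y - cupr x y'.
Proof. by rewrite cuprDr cuprNr. Qed.

(** Split [x] into homogeneous parts: the sign exponent of graded commutativity is [n.*2 * m], which
    is even. This covers Euler classes, and the unit as the case [n = 0]. *)
Lemma cupr_even_comm (n : nat) e x :
  homogeneous n.*2%:Z e -> cupr e x = cupr x e.
Proof.
move=> he; have [s _ ->] := hcomp_sum x.
elim: s => [|m s IH]; first by rewrite !big_nil cupr0 cup0r.
rewrite !big_cons cuprDl cuprDr IH -he; congr (_ + _).
pose ex := @excisive0 X (iset0 X) : excisive (iset0 X : set X) (iset0 X).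
rewrite [LHS](cupC _ _ ex (esym (set0U _))).
by rewrite abszM absz_nat -signr_odd oddM odd_double scale1r.
Qed.

Lemma cdividesB e x y : cdivides e x -> cdivides e y -> cdivides e (x - y).
Proof. by move=> [a ->] [b ->]; exists (a - b); rewrite cuprBr. Qed.

Definition cuprod (I : Type) (e : I -> coh E (abs X)) (s : seq I) :=
  foldr (fun i p => cupr (e i) p) (coh1 E X) s.

(** By associativity the tail of the product is cancelled first, by induction, and then the head.
    The empty product is a left unit, and a right unit because it has degree 0. *)
Lemma cuprod_regular (I : Type) (e : I -> coh E (abs X)) (s : seq I) x :
  (forall i, nonzerodivisor (e i)) -> cupr x (cuprod e s) = 0 -> x = 0.
Proof.
move=> reg; elim: s x => [|i s IH] x /=.
  by rewrite -(@cupr_even_comm 0) ?cup1r //; exact: coh1_degree.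
by rewrite cuprA => /IH xe; apply: (reg i); right.
Qed.

(** Write [x] as [e i] times [a]. For each later [j], coprimality gives [x = e i * e j * b], and
    cancelling the regular [e i] shows that [e j] divides [a]; the induction hypothesis then applies
    to [a]. *)
Lemma cuprod_divides (I : eqType) (e : I -> coh E (abs X)) (s : seq I) x :
  (forall i, nonzerodivisor (e i)) ->
  (forall i j, i != j -> relatively_prime (e i) (e j)) ->
  uniq s -> (forall i, i \in s -> cdivides (e i) x) -> cdivides (cuprod e s) x.
Proof.
move=> reg cop; elim: s x => [|i s IH] x /=.
  by move=> _ _; exists x; rewrite cup1r.
move=> /andP[is_ us] dv.
have [a xa] := dv i (mem_head _ _).
have [j js|d ad] := IH a us; last by exists d; rewrite -cuprA -ad.
have ij : i != j by apply: contraNneq is_ => ->.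
have [||b] := cop i j ij x; [by apply: dv; rewrite mem_head|
  by apply: dv; rewrite inE js orbT|].
rewrite xa -cuprA => /eqP; rewrite -subr_eq0 -cuprBr => /eqP h.
exists b; apply/eqP; rewrite -subr_eq0; apply/eqP.
by apply: (reg i); left.
Qed.

End Ring.

Lemma gpull_cupr (X Y : gspace G) (f : gmap X Y) (x y : coh E (abs Y)) :
  gpull f (cupr x y) = cupr (gpull f x) (gpull f y).
Proof. exact: cup_natural. Qed.

Lemma gpull_cuprod (X Y : gspace G) (f : gmap X Y) (I : Type)
    (e : I -> coh E (abs Y)) (s : seq I) :
  gpull f (cuprod e s) = cuprod (fun i => gpull f (e i)) s.
Proof.
by elim: s => [|i s IH] /=; [exact: pull_coh1|rewrite gpull_cupr IH].
Qed.

Definition vanishes_on (X : gspace G) (U : iset X) (a : coh E (abs X)) : Prop :=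
  gpull (gsub_incl U) a = 0.

Lemma vanishes_on_setT (X : gspace G) (U : iset X) (a : coh E (abs X)) :
  (U : set X) = setT -> vanishes_on U a -> a = 0.
Proof.
move=> UT aU; have h x : iset_set U (gid X x) by rewrite UT.
rewrite -(pull_id a) -(gpull0 (gcorestrict h)) -aU.
rewrite (@gpull_comp_ext _ _ _ _ _ (gid X)) //.
by apply: pull_ext.
Qed.

(* The two classes lift to classes relative to U and U'; the relative product of
   the lifts is a class relative to the union. *)
Lemma vanishes_on_cup (X : gspace G) (U U' : iset X) (a b : coh E (abs X)) :
  open (U : set X) -> open (U' : set X) ->
  vanishes_on U a -> vanishes_on U' b ->
  vanishes_on (isetU U U') (cupr a b).
Proof.
move=> oU oU' /(@exact_spaceP (GPair U))[a' ->].
move=> /(@exact_spaceP (GPair U'))[b' ->].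
pose UU := GPair (isetU U U').
have <- : pull E (rel_map UU) (cup (excisive_open oU oU')
      (erefl : (isetU U U' : set X) = U `|` U') a' b') =
    cupr (pull E (rel_map (GPair U)) a') (pull E (rel_map (GPair U')) b').
  exact: (@cup_natural R G E X X (iset0 X) (iset0 X) (iset0 X)).
exact: (@pull_rel_sub UU).
Qed.

Fixpoint iset_cover (X : gspace G) (I : Type) (U : I -> iset X) (s : seq I) :=
  if s is i :: s' then isetU (U i) (iset_cover U s') else iset0 X.

Lemma iset_coverP (X : gspace G) (I : eqType) (U : I -> iset X) (s : seq I) x :
  iset_set (iset_cover U s) x <-> exists2 i, i \in s & iset_set (U i) x.
Proof.
elim: s => [|i s IH] /=; first by split=> // -[].
split=> [[Ux|/IH[j js Ux]]|[j]].
- by exists i => //; rewrite mem_head.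
- by exists j => //; rewrite inE js orbT.
- rewrite inE => /orP[/eqP -> Ux|js Ux]; first by left.
  by right; apply/IH; exists j.
Qed.

Lemma iset_cover_open (X : gspace G) (I : Type) (U : I -> iset X) (s : seq I) :
  (forall i, open (U i : set X)) -> open (iset_cover U s : set X).
Proof.
by move=> oU; elim: s => [|i s IH] /=; [exact: open0|exact: openU].
Qed.

(** Every class is already a class relative to the empty set, and relative classes restrict to zero
    on the subspace. *)
Lemma vanishes_on_iset0 (X : gspace G) (a : coh E (abs X)) :
  vanishes_on (iset0 X) a.
Proof.
have <- : pull E (rel_map (abs X)) a = a.
  by rewrite -[RHS]pull_id; exact: pull_ext.
exact: (@pull_rel_sub (abs X)).
Qed.

Lemma cuprod_vanishes (X : gspace G) (I : Type) (U : I -> iset X)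
    (a : I -> coh E (abs X)) (s : seq I) :
  (forall i, open (U i : set X)) -> (forall i, vanishes_on (U i) (a i)) ->
  vanishes_on (iset_cover U s) (cuprod a s).
Proof.
move=> oU aU; elim: s => [|i s IH] /=; first exact: vanishes_on_iset0.
by apply: vanishes_on_cup => //; exact: iset_cover_open.
Qed.

End Cohomology.

(** * Relative homeomorphisms induce isomorphisms *)

Lemma continuous_pair_for (T U V : topologicalType) (f : T -> U) (g : T -> V)
    (x : T) :
  {for x, continuous f} -> {for x, continuous g} ->
  {for x, continuous (fun y => (f y, g y))}.
Proof. by move=> cf cg; apply: cvg_pair; [exact: cf|exact: cg]. Qed.

Lemma continuous_pair (T U V : topologicalType) (f : T -> U) (g : T -> V) :
  continuous f -> continuous g -> continuous (fun x => (f x, g x)).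
Proof.
by move=> cf cg x; apply: continuous_pair_for; [exact: cf|exact: cg].
Qed.

Lemma continuousT_comp (T U V : topologicalType) (f : T -> U) (g : U -> V) :
  continuous f -> continuous g -> continuous (g \o f).
Proof. by move=> cf cg x; apply: continuous_comp; [exact: cf|exact: cg]. Qed.

(** * Collars and their extension over an attached space *)

Section Collars.
Context {R : realType} {G : topGroupType}.

(** A deformation of the whole space that fixes the subspace and pushes an open neighbourhood into
    it by time 1. Time runs over all of [R], so that continuity needs no restriction to an
    interval. *)
Record collar (P : gpair G) := Collar {
  col_nbhs : iset (psp P);
  col_push : R * psp P -> psp P;
  col_sub : iset_set (psub P) `<=` iset_set col_nbhs;
  col_closed : closed (iset_set (psub P));
  col_open : open (iset_set col_nbhs);
  col_continuous : continuous col_push;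
  col_equivariant : forall t g x,
    col_push (t, gact g x) = gact g (col_push (t, x));
  col_push0 : forall x, col_push (0, x) = x;
  col_push_sub : forall t x, iset_set (psub P) x -> col_push (t, x) = x;
  col_push1 : forall x, iset_set col_nbhs x ->
    iset_set (psub P) (col_push (1, x));
  col_push_nbhs : forall t x, iset_set col_nbhs x ->
    iset_set col_nbhs (col_push (t, x)) }.

Section Attaching.
Variables (P : gpair G) (c : collar P) (Z : gspace G) (Y : iset Z).
Variable chi : pmap P (GPair Y).
Hypothesis att : attached (iset_set Y) setT (iset_set (psub P)) chi.

Lemma att_subE d : iset_set Y (chi d) <-> iset_set (psub P) d.
Proof.
have [_ _ cS [cb _ _] _] := att; split=> [Yd|Sd]; last by apply: cS; exists d.
by apply: contrapT => nSd; have [] := cb d nSd.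
Qed.

Lemma att_inj d d' : ~ iset_set (psub P) d -> chi d = chi d' -> d = d'.
Proof.
have [_ _ _ [_ ci _] _] := att; move=> nSd e.
have nSd' : ~ iset_set (psub P) d'.
  by move=> Sd'; apply: nSd; apply/att_subE; rewrite e; apply/att_subE.
by apply: ci; rewrite ?inE.
Qed.

Lemma att_surj z : ~ iset_set Y z -> exists d, z = chi d.
Proof.
have [_ _ _ [_ _ cs] _] := att; move=> nYz.
by have [//|d _ <-] := cs z; exists d.
Qed.

Lemma att_closed (A : set Z) :
  closed (A `&` iset_set Y) -> closed (chi @^-1` A) -> closed A.
Proof. by have [_ _ _ _ top] := att; exact: top. Qed.

(** The push on [P] descends along [chi]: off the subspace [chi] is injective, and the points with
    image in [Y] are fixed by the push. *)
Lemma att_push_exists : exists K : R * Z -> Z,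
  (forall t z, iset_set Y z -> K (t, z) = z) /\
  forall t d, K (t, chi d) = chi (col_push c (t, d)).
Proof.
have KP (tz : R * Z) : exists z', (iset_set Y tz.2 -> z' = tz.2) /\
    forall d, tz.2 = chi d -> z' = chi (col_push c (tz.1, d)).
  case: tz => t z /=; have [Yz|nYz] := pselect (iset_set Y z).
    exists z; split=> // d e; rewrite col_push_sub //.
    by apply/att_subE; rewrite -e.
  have [d zd] := att_surj nYz; exists (chi (col_push c (t, d))).
  split=> // d' e.
  have -> // : d = d'; apply: att_inj; last by rewrite -zd.
  by move=> /att_subE; rewrite -zd.
exists (fun tz => projT1 (cid (KP tz))); split=> [t z Yz|t d];
  case: cid => z' [/= hY hd]; first exact: hY.
exact: hd.
Qed.

Definition att_push : R * Z -> Z := projT1 (cid att_push_exists).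

Lemma att_push_base t z : iset_set Y z -> att_push (t, z) = z.
Proof. by rewrite /att_push; case: cid => K [+ _] /=; exact. Qed.

Lemma att_push_char t d : att_push (t, chi d) = chi (col_push c (t, d)).
Proof. by rewrite /att_push; case: cid => K [_ +] /=; exact. Qed.

(* Y need not be locally compact, so that [R * Z] does not obviously carry the
   quotient topology; compactness of a closed interval of parameters is used
   instead. *)
Lemma att_push_continuous : continuous att_push.
Proof.
move=> [t z] O; rewrite nbhsE => -[Q [oQ Qz] sQ].
have [e [e0 eJ]] : exists e, 0 < e /\
    forall s, s \in `[t - e, t + e] -> Q (att_push (s, z)).
  have : nbhs t [set s | Q (att_push (s, z))].
    have [Yz|/att_surj[d zd]] := pselect (iset_set Y z).
      apply: filterE => s /=; rewrite att_push_base //.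
      by rewrite att_push_base in Qz.
    suff : {for t, continuous (fun s => att_push (s, z))}.
      by move=> h; apply: h; exact: open_nbhs_nbhs.
    rewrite (_ : (fun s => _) = (chi \o col_push c) \o (fun s => (s, d))).
      apply: continuous_comp.
        by apply: continuous_pair => x; [exact: cvg_id|exact: cvg_cst].
      apply: continuous_comp; first exact: col_continuous.
      exact: gfun_continuous.
    by apply/funext => s /=; rewrite zd att_push_char.
  move=> /nbhs_closedballP[e]; rewrite closed_ball_itv // => h.
  by exists e%:num; split.
pose J := `[t - e, t + e]%classic.
(* [W] consists of the points that stay in [Q] during all of [J]. Its openness is tested on [Y],
   where the push is stationary, and on [P], where the tube lemma over the compact interval [J]
   applies. *)
pose W := [set x | forall s, J s -> Q (att_push (s, x))].
have Jt : J t by rewrite /J /= in_itv /= lerBlDr lerDl !(ltW e0).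
have oW : open W.
  rewrite -closedC; apply: att_closed.
    rewrite (_ : _ `&` _ = ~` Q `&` iset_set Y).
      by apply: closedI; [exact: open_closedC|have [] := att].
    apply/seteqP; split=> x /= -[nW Yx]; split=> // h; apply: nW.
      by move=> s _; rewrite att_push_base.
    by have := h _ Jt; rewrite att_push_base.
  rewrite -preimage_setC closedC openE => d /= Wd.
  have /compact_near_coveringP := @segment_compact _ (t - e) (t + e).
  move=> /(_ (psp P) (nbhs d) (fun d s => Q (att_push (s, chi d)))).
  apply=> s Js.
  have : nbhs (col_push c (s, d)) (chi @^-1` Q).
    apply: (@gfun_continuous _ _ _ chi); apply: open_nbhs_nbhs; split=> //.
    by rewrite -att_push_char; exact: Wd.
  move=> /col_continuous [[A B] /= [nA nB] AB].
  exists (A, B) => //= -[s' d'] [/= As' Bd']; rewrite att_push_char.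
  exact: (AB (s', d')).
exists (J, W) => /=; last by move=> [s x] [/= Js Wx]; apply: sQ; exact: Wx.
split; last by apply: open_nbhs_nbhs; split.
by rewrite /J -closed_ball_itv //; apply/nbhs_closedballP; exists (PosNum e0).
Qed.

Lemma att_push_equivariant t g z :
  att_push (t, gact g z) = gact g (att_push (t, z)).
Proof.
have [Yz|/att_surj[d ->]] := pselect (iset_set Y z).
  by rewrite !att_push_base //; exact: iset_inv.
by rewrite -gfun_equivariant !att_push_char col_equivariant gfun_equivariant.
Qed.

Lemma att_push0 z : att_push (0, z) = z.
Proof.
have [Yz|/att_surj[d ->]] := pselect (iset_set Y z).
  exact: att_push_base.
by rewrite att_push_char col_push0.
Qed.

Definition att_nbhs : iset Z := isetU Y (iset_image chi (col_nbhs c)).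

Lemma att_nbhs_char d : iset_set att_nbhs (chi d) <-> iset_set (col_nbhs c) d.
Proof.
split=> [[/att_subE/col_sub //|[d' Nd' /esym e]]|Nd]; last by right; exists d.
have [/col_sub //|nSd] := pselect (iset_set (psub P) d).
by rewrite (att_inj nSd e).
Qed.

Lemma att_nbhs_open : open (iset_set att_nbhs).
Proof.
rewrite -closedC; apply: att_closed.
  rewrite (_ : _ `&` _ = set0); first exact: closed0.
  by apply/seteqP; split=> // x [nN Yx]; apply: nN; left.
rewrite -preimage_setC closedC (_ : _ @^-1` _ = iset_set (col_nbhs c)).
  exact: col_open.
by apply/seteqP; split=> d /att_nbhs_char.
Qed.

Lemma att_push_nbhs t z :
  iset_set att_nbhs z -> iset_set att_nbhs (att_push (t, z)).
Proof.
case=> [Yz|[d Nd <-]]; first by rewrite att_push_base //; left.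
by rewrite att_push_char; apply/att_nbhs_char; exact: col_push_nbhs.
Qed.

Lemma att_push1 z : iset_set att_nbhs z -> iset_set Y (att_push (1, z)).
Proof.
case=> [Yz|[d Nd <-]]; first by rewrite att_push_base.
by rewrite att_push_char; apply/att_subE; exact: col_push1.
Qed.

Lemma att_retract_continuous : continuous (fun z => att_push (1, z)).
Proof.
apply: (@continuousT_comp _ _ _ (fun z : Z => (1 : R, z)) att_push).
  by apply: continuous_pair => x; [exact: cvg_cst|exact: cvg_id].
exact: att_push_continuous.
Qed.

Definition att_retract : pmap (GPair att_nbhs) (GPair Y) :=
  @PMap _ (GPair att_nbhs) (GPair Y)
    (GMap att_retract_continuous (att_push_equivariant 1)) att_push1.

Definition att_widen : pmap (GPair Y) (GPair att_nbhs) :=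
  @PMap _ (GPair Y) (GPair att_nbhs) (gid Z) (fun z Yz => or_introl Yz).

Lemma homotopic_att_push (A : iset Z) (f h : pmap (GPair A) (GPair A)) :
  (forall t z, iset_set A z -> iset_set A (att_push (t, z))) ->
  (forall z, f z = z) -> (forall z, h z = att_push (1, z)) ->
  homotopic R f h.
Proof.
move=> hA fE hE; exists att_push; split=> //.
- exact/continuous_subspaceT/att_push_continuous.
- by move=> z; rewrite att_push0 fE.
- by move=> t z g _; exact: att_push_equivariant.
- by move=> t z _; exact: hA.
Qed.

Context {E : cohomology_theory R G}.

(** The push at time 1 is a homotopy inverse: both composites are the time 1 push, and the push at
    intermediate times preserves [Y] as well as its neighbourhood. *)
Lemma att_widen_bij : bijective (pull E att_widen).
Proof.
exists (pull E att_retract) => x; rewrite -pull_comp -[RHS]pull_id; symmetry;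
  apply: pull_homotopic; apply: homotopic_att_push => //.
  exact: att_push_nbhs.
by move=> t z Yz; rewrite att_push_base.
Qed.

End Attaching.
End Collars.

Arguments collar R {G} P.

(** * Comparison of an attached pair with its model by excision *)

Section RelativeHomeomorphism.
Context {R : realType} {G : topGroupType} {E : cohomology_theory R G}.

Definition isetC (X : gspace G) (A : iset X) : iset X := isetD (isetT X) A.

(** Lets the constructions made for [chi] be applied to [P] itself, so that both sides of the
    comparison are treated alike. *)
Lemma attached_id (P : gpair G) :
  closed (iset_set (psub P)) ->
  attached (iset_set (psub P)) setT (iset_set (psub P)) (pid P).
Proof.
move=> cS; split=> //.
- by move=> x [y Sy <-].
- split=> [x nSx|x y _ _ //|x [_ nSx]]; first by split.
  by exists x.
Qed.

Section Interior.
Variables (P : gpair G) (Z : gspace G) (Y : iset Z).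
Variable chi : pmap P (GPair Y).
Hypothesis att : attached (iset_set Y) setT (iset_set (psub P)) chi.

(** The image misses [Y], and by injectivity its preimage is again [U] without the subspace, so the
    attaching topology makes it open. This yields continuity of the inverse of [chi] off [Y]. *)
Lemma att_image_open (U : set (psp P)) : open U ->
  open (chi @` (U `\` iset_set (psub P))).
Proof.
have cY : closed (iset_set Y) by have [] := att.
move=> oU; rewrite -closedC; apply: (att_closed att).
  rewrite (_ : _ `&` _ = iset_set Y) //; apply/seteqP; split=> z.
    by case.
  move=> Yz; split=> // -[d [_ nSd] e].
  by apply: nSd; apply/(att_subE att); rewrite e.
rewrite -preimage_setC closedC.
rewrite (_ : _ @^-1` _ = U `&` ~` iset_set (psub P)).
  apply: openI => //; rewrite openC.
  rewrite (_ : iset_set _ = chi @^-1` iset_set Y).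
    by have /continuous_closedP := @gfun_continuous _ _ _ chi; apply.
  by apply/seteqP; split=> d /(att_subE att).
apply/seteqP; split=> [d [d' [Ud' nSd'] e]|d [Ud nSd]]; last by exists d.
by rewrite -(att_inj att nSd' e).
Qed.

Lemma att_interior d :
  iset_set (isetC (psub P)) d -> iset_set (isetC Y) (chi d).
Proof. by move=> [_ nSd]; split=> // /(att_subE att). Qed.

Lemma att_lift (z : gsub (isetC Y)) :
  exists d : gsub (isetC (psub P)), chi (set_val d) = set_val z.
Proof.
have [_ nYz] : iset_set (isetC Y) (set_val z) := set_valP z.
have [d zd] := att_surj att nYz.
have nSd : iset_set (isetC (psub P)) d.
  by split=> // /(att_subE att); rewrite -zd.
by exists (exist _ d (mem_set nSd)).
Qed.

Definition att_inv (z : gsub (isetC Y)) : gsub (isetC (psub P)) :=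
  projT1 (cid (att_lift z)).

Lemma att_invK z : chi (set_val (att_inv z)) = set_val z.
Proof. by rewrite /att_inv; case: cid. Qed.

Lemma att_inv_unique (d d' : gsub (isetC (psub P))) :
  chi (set_val d) = chi (set_val d') -> d = d'.
Proof.
have [_ nSd] : iset_set (isetC (psub P)) (set_val d) := set_valP d.
by move=> /(att_inj att nSd) e; exact: val_inj.
Qed.

Lemma att_inv_continuous : continuous att_inv.
Proof.
apply: continuous_into_sub; apply/continuousP => U oU.
rewrite (_ : _ @^-1` _ = set_val @^-1` (chi @` (U `\` iset_set (psub P)))).
  have /continuousP := @set_val_continuous _ _ (isetC Y); apply.
  exact: att_image_open.
apply/seteqP; split=> [z Uz|z [d [Ud nSd] e]] /=.
  exists (set_val (att_inv z)); last exact: att_invK.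
  by split=> //; case: (set_valP (att_inv z)).
rewrite -(att_invK z) in e.
by rewrite -(att_inj att nSd e).
Qed.

Lemma att_inv_equivariant g z : att_inv (gact g z) = gact g (att_inv z).
Proof.
apply: att_inv_unique; rewrite att_invK.
by rewrite [RHS](gfun_equivariant chi g) att_invK.
Qed.

Definition att_inv_map : gmap (gsub (isetC Y)) (gsub (isetC (psub P))) :=
  GMap att_inv_continuous att_inv_equivariant.

Definition att_interior_map : gmap (gsub (isetC (psub P))) (gsub (isetC Y)) :=
  grestrict att_interior.

Lemma att_interior_mapK : cancel att_interior_map att_inv_map.
Proof. by move=> d; apply: att_inv_unique; rewrite /= att_invK. Qed.

Lemma att_inv_mapK : cancel att_inv_map att_interior_map.
Proof. by move=> z; apply: val_inj; rewrite /= att_invK. Qed.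

End Interior.

Lemma excision_isetC_bij (X : gspace G) (A N : iset X) :
  closed (iset_set A) -> open (iset_set N) -> iset_set A `<=` iset_set N ->
  bijective (pull E (excision_map (isetC A) N)).
Proof.
move=> cA oN AN; apply: excision.
  apply/seteqP; split=> // x _.
  by have [Ax|nAx] := pselect (iset_set A x); [right; exact: AN|left].
by apply: excisive_open => //=; rewrite setTD openC.
Qed.

(** On both sides the subspace is widened to its collar neighbourhood and then excised, each step
    being an isomorphism. What remains of [chi] is a homeomorphism of pairs between the complements,
    and two commuting squares carry bijectivity back to [chi]. *)
Theorem pull_attached_bij (P : gpair G) (c : collar R P) (Z : gspace G)
    (Y : iset Z) (chi : pmap P (GPair Y)) :
  attached (iset_set Y) setT (iset_set (psub P)) chi ->
  bijective (pull E chi).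
Proof.
case: P c chi => D S c chi /= att.
have attD := attached_id (col_closed c).
pose ND := att_nbhs c (pid (GPair S)); pose NZ := att_nbhs c chi.
have hN d : iset_set ND d -> iset_set NZ (chi d).
  by move=> /(att_nbhs_char c attD) Nd; apply/(att_nbhs_char c att).
have hN' d : iset_set NZ (chi d) -> iset_set ND d.
  by move=> /(att_nbhs_char c att) Nd; apply/(att_nbhs_char c attD).
pose chiN : pmap (GPair ND) (GPair NZ) := @PMap _ (GPair ND) (GPair NZ) chi hN.
pose wD : pmap (GPair S) (GPair ND) := att_widen c (pid (GPair S)).
pose wZ := att_widen c chi.
have bD : bijective (pull E wD) by exact: att_widen_bij.
have bZ : bijective (pull E wZ) by exact: att_widen_bij.
pose xD := excision_map (isetC S) ND; pose xZ := excision_map (isetC Y) NZ.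
have bxD : bijective (pull E xD).
  apply: excision_isetC_bij; first exact: col_closed c.
    exact: att_nbhs_open.
  by left.
have bxZ : bijective (pull E xZ).
  apply: excision_isetC_bij; first by have [] := att.
    exact: att_nbhs_open.
  by left.
pose PD := GPair (isetI_pre (gsub_incl (isetC S)) ND).
pose PZ := GPair (isetI_pre (gsub_incl (isetC Y)) NZ).
pose aint := @att_interior_map (GPair S) Z Y chi att.
pose ainv := @att_inv_map (GPair S) Z Y chi att.
have hi d : iset_set (psub PD) d ->
    iset_set (psub PZ) (aint d) by exact: hN.
have hj z : iset_set (psub PZ) z -> iset_set (psub PD) (ainv z).
  by move=> Nz; apply: hN'; rewrite att_invK.
pose ci : pmap PD PZ := PMap hi; pose cj : pmap PZ PD := PMap hj.
have bi : bijective (pull E ci).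
  apply: (@pull_bij_inv _ _ _ _ _ _ cj).
    exact: (@att_interior_mapK (GPair S) Z Y chi att).
  exact: (@att_inv_mapK (GPair S) Z Y chi att).
have bN : bijective (pull E chiN).
  have : bijective (pull E xD \o pull E chiN).
    apply: (eq_bij (bij_comp bi bxZ)) => x /=.
    by rewrite -!pull_comp; exact: pull_ext.
  case: bxD => f xDK fK [h h1 h2]; exists (h \o pull E xD) => x /=.
    exact: h1.
  by rewrite -[LHS]xDK [X in f X]h2 xDK.
have : bijective (pull E chi \o pull E wZ).
  apply: (eq_bij (bij_comp bD bN)) => x /=.
  by rewrite -!pull_comp; exact: pull_ext.
case: bZ => f wK fK [h h1 h2]; exists (pull E wZ \o h) => x /=.
  by rewrite -[x]fK [X in pull E wZ X]h1.
exact: h2.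
Qed.

End RelativeHomeomorphism.

(** * Radial structure of bundles and of their orbit spaces *)

Section RealComplex.
Variable R : realType.

Definition toC (x : R) : Cplx R := x%:C%C.
Definition reC (x : Cplx R) : R := complex.Re x.

Lemma toC_continuous : continuous toC.
Proof.
move=> x; apply/(@cvgrPdist_lt _ (Cplx R)^o) => e e0.
(* Positivity in [R[i]] forces the imaginary part to vanish, so the radius [e] is the real number
   [Re e]. *)
have e0' : 0 < complex.Re e.
  by move: e0; case: e => a b; rewrite ltcE /= => /andP[].
have := @nbhsx_ballx _ R^o x _ e0'; apply: filterS => y.
rewrite /toC -rmorphB normc_def /= expr0n addr0 sqrtr_sqr => h1.
move: e0 h1; case: e {e0'} => a b; rewrite !ltcE /= => /andP[/eqP -> _] ->.
by rewrite eqxx.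
Qed.

Lemma reC_continuous : continuous reC.
Proof.
move=> x; apply/(@cvgrPdist_lt _ R^o _ (nbhs x) (nbhs_filter x)) => e e0.
have e0' : 0 < toC e by rewrite ltcE /= eqxx.
have := @nbhsx_ballx _ (Cplx R)^o x _ e0'; apply: filterS => y xy.
have := le_lt_trans (normc_ge_Re _) xy; rewrite ltcE /= => /andP[_].
by case: x y {xy} => [a b] [c d].
Qed.

Lemma conj_toC x : Num.conj (toC x) = toC x.
Proof. exact: conjc_real. Qed.

Lemma ge0_toC (x : Cplx R) : 0 <= x -> x = toC (reC x).
Proof. by case: x => a b; rewrite lecE /toC /= => /andP[/eqP -> _]. Qed.

Lemma le_toC (x y : R) : (toC x <= toC y) = (x <= y).
Proof. by rewrite lecE /= eqxx. Qed.

End RealComplex.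

Section BundleNorm.
Context {R : realType} {G : topGroupType} {B : gspace G} (V : cvbundle R B).
Implicit Types v w : V.

(** The laws of scaling are given only in local trivialisations; in this form they can be read off
    fibrewise at any vector over [U]. *)
Lemma vb_scale_frame v : exists (U : set B)
    (t : B * 'rV[Cplx R]_(vb_rank V) -> V) (s : V -> 'rV[Cplx R]_(vb_rank V)),
  [/\ open_nbhs (vb_proj V v) U, {within U `*` setT, continuous t},
      {within vb_proj V @^-1` U, continuous s},
      forall w, U (vb_proj V w) -> t (vb_proj V w, s w) = w &
      forall c w, U (vb_proj V w) ->
        [/\ vb_scale c w = t (vb_proj V w, c *: s w),
            vb_proj V (t (vb_proj V w, c *: s w)) = vb_proj V w &
            t (vb_proj V w, 0) = vb_zero V (vb_proj V w)]].
Proof.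
have [U [t [s [oU ct cs tK tP]]]] := vb_trivial V (vb_proj V v).
exists U, t, s; split=> // c w Uw.
have [tp ts tA tZ t0] := tP _ Uw; split=> //.
by rewrite tZ tK.
Qed.

Lemma vb_proj_scale c v : vb_proj V (vb_scale c v) = vb_proj V v.
Proof.
have [U [t [s [[_ Uv] _ _ tK /(_ c v Uv)[-> -> _]]]]] := vb_scale_frame v.
by [].
Qed.

Lemma vb_scale1 v : vb_scale 1 v = v.
Proof.
have [U [t [s [[_ Uv] _ _ tK /(_ 1 v Uv)[-> _ _]]]]] := vb_scale_frame v.
by rewrite scale1r tK.
Qed.

Lemma vb_scale0 v : vb_scale 0 v = vb_zero V (vb_proj V v).
Proof.
have [U [t [s [[_ Uv] _ _ tK /(_ 0 v Uv)[-> _ <-]]]]] := vb_scale_frame v.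
by rewrite scale0r.
Qed.

Lemma vb_proj_zero b : vb_proj V (vb_zero V b) = b.
Proof.
have [U [t [s [[_ Ub] _ _ _ /(_ _ Ub)[tp _ _ _ t0]]]]] := vb_trivial V b.
by rewrite -t0 tp.
Qed.

Lemma vb_scale_continuous :
  continuous (fun cv : Cplx R * V => vb_scale cv.1 cv.2).
Proof.
move=> [c v] /= O.
have [U [t [s [[oU Uv] ct cs tK sc]]]] := vb_scale_frame v.
have [-> _ _] := sc c v Uv.
have oUT : open (U `*` [set: 'rV[Cplx R]_(vb_rank V)]).
  rewrite openE => -[b x] [/= Ub _]; exists (U, setT) => //=.
  by split; [exact: open_nbhs_nbhs|exact: filterT].
have oVU : open (vb_proj V @^-1` U).
  by have /continuousP := @gfun_continuous _ _ _ (vb_proj V); exact.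
have ctv : {for (vb_proj V v, c *: s v), continuous t}.
  move: ct; rewrite continuous_open_subspace // => /(_ _); apply.
  by rewrite inE.
have csv : {for v, continuous s}.
  move: cs; rewrite continuous_open_subspace // => /(_ _); apply.
  by rewrite inE.
move=> /ctv nO.
have : {for (c, v), continuous
    (fun cw : Cplx R * V => (vb_proj V cw.2, cw.1 *: s cw.2))}.
  apply: continuous_pair_for.
    apply: (@continuous_comp _ _ _ snd (vb_proj V)); first exact: cvg_snd.
    exact: gfun_continuous.
  apply: cvgZ; first exact: cvg_fst.
  by apply: (@continuous_comp _ _ _ snd s); [exact: cvg_snd|exact: csv].
move=> /(_ _ nO) /= H.
have nU : nbhs (c, v) [set cw : Cplx R * V | U (vb_proj V cw.2)].
  apply: (@cvg_snd _ _ (nbhs c) (nbhs v) _ (vb_proj V @^-1` U)).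
  exact: open_nbhs_nbhs.
change (nbhs (c, v) [set cw : Cplx R * V | O (vb_scale cw.1 cw.2)]).
apply: (@filterS2 _ _ (nbhs_filter ((c, v) : Cplx R * V)) _ _ _ _ H nU).
move=> -[c' w] /= Ow Uw.
by have [-> _ _] := sc c' w Uw.
Qed.

Lemma vb_ip_ge0 v : 0 <= vb_ip v v.
Proof.
have [->|/vb_ip_pos/ltW //] := pselect (v = vb_zero V (vb_proj V v)).
by rewrite vb_ip0.
Qed.

Definition vnorm v : R := Num.sqrt (reC (vb_ip v v)).

Lemma vb_ipE v : vb_ip v v = toC (vnorm v ^+ 2).
Proof.
rewrite /vnorm sqr_sqrtr; first exact/ge0_toC/vb_ip_ge0.
by rewrite -le_toC -ge0_toC ?vb_ip_ge0.
Qed.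

Lemma vnorm_ge0 v : 0 <= vnorm v.
Proof. exact: sqrtr_ge0. Qed.

Lemma vnorm_disc v : vb_ip v v <= 1 <-> vnorm v <= 1.
Proof.
rewrite vb_ipE -[1 in X in X <-> _]/(toC 1) le_toC.
by rewrite -[1 in X in X <-> _](expr1n _ 2) ler_sqr ?nnegrE ?vnorm_ge0.
Qed.

Lemma vnorm_sphere v : vb_ip v v = 1 <-> vnorm v = 1.
Proof.
rewrite vb_ipE; split=> [|->]; last by rewrite expr1n.
move=> /(congr1 (@reC R)) /= /eqP.
by rewrite sqrp_eq1 ?vnorm_ge0 // => /eqP.
Qed.

Lemma vnorm_eq0 v : vnorm v = 0 -> v = vb_zero V (vb_proj V v).
Proof.
move=> v0; apply: contrapT => /vb_ip_pos.
by rewrite vb_ipE v0 expr0n ltxx.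
Qed.

Lemma vnorm_act g v : vnorm (gact g v) = vnorm v.
Proof. by rewrite /vnorm vb_act_ip. Qed.

Lemma vnorm_scale r v : vnorm (vb_scale (toC r) v) = `|r| * vnorm v.
Proof.
rewrite {1}/vnorm vb_ip_scale ?vb_proj_scale //.
rewrite [X in reC (_ * X)]vb_ip_conj ?vb_proj_scale //.
rewrite vb_ip_scale // rmorphM /= conj_toC vb_ipE conj_toC.
rewrite -!rmorphM /= mulrA -expr2 -exprMn sqrtr_sqr normrM.
by rewrite (ger0_norm (vnorm_ge0 v)).
Qed.

Lemma vnorm_continuous : continuous vnorm.
Proof.
move=> v; apply: (@continuous_comp _ _ _ (fun v => reC (vb_ip v v)) Num.sqrt);
  last exact: sqrt_continuous.
apply: (@continuous_comp _ _ _ (fun v => vb_ip v v) (@reC R));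
  last exact: reC_continuous.
(* The inner product is continuous on the fibre product of [V] with itself, which contains the
   diagonal. *)
move=> O nO; have /subspace_continuousP := @vb_ip_continuous _ _ _ V.
move=> /(_ (v, v) erefl O nO) /= H.
have cdiag : continuous (fun w : V => (w, w)).
  by apply: continuous_pair => w; exact: cvg_id.
change (nbhs v [set w | O (vb_ip w w)]).
apply: (@filterS _ _ (nbhs_filter v) _ _ _ (cdiag v _ H)) => w /=; exact.
Qed.

End BundleNorm.

Lemma vnorm_isometric (R : realType) (G : topGroupType) (B B' : gspace G)
    (V : cvbundle R B) (V' : cvbundle R B') (F : V -> V') (v : V) :
  isometric F -> vnorm (F v) = vnorm v.
Proof. by move=> hF; rewrite /vnorm hF. Qed.

(** * Norm and scaling on the orbit space *)

Section OrbitMaps.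
Context {R : realType} {G : topGroupType} {B : gspace G} {V : cvbundle R B}.
Variable A : linear_action V.

Section Descent.
Variables (Z : gspace G) (F : gmap V Z).
Hypothesis hF : forall v v', orbit_fun A v = orbit_fun A v' -> F v = F v'.

Definition orbit_desc_fun (q : orbit_gspace A) : Z := F (orbit_repr q).

Lemma orbit_desc_pi v : orbit_desc_fun (orbit_fun A v) = F v.
Proof. by apply: hF; rewrite orbit_fun_repr. Qed.

Lemma orbit_desc_continuous : continuous orbit_desc_fun.
Proof.
apply/continuousP => U oU.
change (open (orbit_fun A @^-1` (orbit_desc_fun @^-1` U))).
rewrite (_ : _ @^-1` _ = F @^-1` U).
  by have /continuousP := @gfun_continuous _ _ _ F; exact.
by apply/seteqP; split=> v /=; rewrite orbit_desc_pi.
Qed.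

Lemma orbit_desc_equivariant g q :
  orbit_desc_fun (gact g q) = gact g (orbit_desc_fun q).
Proof.
rewrite -[q]orbit_fun_repr /= orbit_act_pi !orbit_desc_pi.
exact: gfun_equivariant.
Qed.

Definition orbit_desc : gmap (orbit_gspace A) Z :=
  GMap orbit_desc_continuous orbit_desc_equivariant.

End Descent.

Implicit Types q : orbit_gspace A.

Definition qnorm q : R := vnorm (orbit_repr q).

Lemma qnorm_pi v : qnorm (orbit_fun A v) = vnorm v.
Proof.
have /orbit_funP[a e] := orbit_fun_repr (orbit_fun A v).
by rewrite /qnorm [in RHS]e vnorm_isometric //; exact: la_isometric.
Qed.

Lemma qnorm_ge0 q : 0 <= qnorm q.
Proof. exact: vnorm_ge0. Qed.

Lemma qnorm_continuous : continuous qnorm.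
Proof.
apply/continuousP => U oU; change (open (orbit_fun A @^-1` (qnorm @^-1` U))).
rewrite (_ : _ @^-1` _ = (@vnorm R G B V) @^-1` U).
  by have /continuousP := @vnorm_continuous _ _ _ V; exact.
by apply/seteqP; split=> v /=; rewrite qnorm_pi.
Qed.

Lemma qnorm_act g q : qnorm (gact g q) = qnorm q.
Proof. by rewrite -[q]orbit_fun_repr /= orbit_act_pi !qnorm_pi vnorm_act. Qed.

Lemma orbit_discE q : iset_set (orbit_disc A) q <-> qnorm q <= 1.
Proof.
split=> [[v /vnorm_disc v1 <-]|q1]; first by rewrite /= qnorm_pi.
by exists (orbit_repr q); [exact/vnorm_disc|exact: orbit_fun_repr].
Qed.

Lemma orbit_sphereE q : iset_set (orbit_sphere A) q <-> qnorm q = 1.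
Proof.
split=> [[v /vnorm_sphere v1 <-]|q1]; first by rewrite /= qnorm_pi.
by exists (orbit_repr q); [exact/vnorm_sphere|exact: orbit_fun_repr].
Qed.

Definition qscale (r : R) q : orbit_gspace A :=
  orbit_fun A (vb_scale (toC r) (orbit_repr q)).

Lemma qscale_pi r v :
  qscale r (orbit_fun A v) = orbit_fun A (vb_scale (toC r) v).
Proof.
have /orbit_funP[a e] := orbit_fun_repr (orbit_fun A v).
apply/orbit_funP; exists a.
by have [_ _ ->] := la_linear a; rewrite -e.
Qed.

Lemma qnorm_scale r q : qnorm (qscale r q) = `|r| * qnorm q.
Proof. by rewrite -[q]orbit_fun_repr qscale_pi !qnorm_pi vnorm_scale. Qed.

Lemma qscale1 q : qscale 1 q = q.
Proof.
by rewrite -[q]orbit_fun_repr qscale_pi [toC 1](_ : _ = 1) ?vb_scale1.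
Qed.

Lemma qscale0 q : qscale 0 q = orbit_fun A (vb_zero V (orbit_proj A q)).
Proof.
rewrite -[q]orbit_fun_repr qscale_pi [toC 0](_ : _ = 0) // vb_scale0 /=.
by rewrite vb_proj_repr.
Qed.

Lemma orbit_proj_pi v : orbit_proj A (orbit_fun A v) = vb_proj V v.
Proof. exact: vb_proj_repr. Qed.

Lemma orbit_proj_scale r q : orbit_proj A (qscale r q) = orbit_proj A q.
Proof.
by rewrite -[q]orbit_fun_repr qscale_pi !orbit_proj_pi vb_proj_scale.
Qed.

Lemma qscale_act r g q : qscale r (gact g q) = gact g (qscale r q).
Proof.
rewrite -[q]orbit_fun_repr /= orbit_act_pi !qscale_pi orbit_act_pi.
by rewrite vb_act_scale.
Qed.

(** The orbit map is open, so a product neighbourhood upstairs has as image a product neighbourhood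
    in [R * (V/A)]; the topology of the product is thus under control without it being a quotient by
    definition. *)
Lemma qscale_continuous :
  continuous (fun rq : R * orbit_gspace A => qscale rq.1 rq.2).
Proof.
move=> [r q]; rewrite -[q]orbit_fun_repr; move: (orbit_repr q) => v O nO.
have csc : continuous
    (fun rv : R * V => orbit_fun A (vb_scale (toC rv.1) rv.2)).
  apply: (@continuousT_comp _ _ _ (fun rv : R * V => vb_scale (toC rv.1) rv.2)).
    apply: (@continuousT_comp _ _ _ (fun rv : R * V => (toC rv.1, rv.2))
      (fun cv : Cplx R * V => vb_scale cv.1 cv.2));
      last exact: vb_scale_continuous.
    apply: continuous_pair; last by move=> x; exact: cvg_snd.
    apply: (@continuousT_comp _ _ _ fst); last exact: toC_continuous.
    by move=> x; exact: cvg_fst.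
  exact: orbit_fun_continuous.
move: nO; rewrite /= qscale_pi => nO.
have [[M N] /= [nM nN] MN] := csc (r, v) O nO.
exists (M, orbit_fun A @` N) => /=; last first.
  move=> [r' _] /= [Mr' [w Nw <-]]; rewrite qscale_pi.
  exact: (MN (r', w)).
split=> //; move: nN; rewrite nbhsE => -[N' [oN' N'v] sN].
apply: (@filterS _ _ (nbhs_filter (orbit_fun A v : orbit_gspace A))
  (orbit_fun A @` N')).
  by move=> _ [w N'w <-]; exists w => //; exact: sN.
apply: open_nbhs_nbhs; split; first exact: orbit_fun_open.
by exists v.
Qed.

Local Notation DP := (orbit_disc_pair A).
Local Notation D := (psp DP).
Implicit Types d : D.

Definition dnorm d : R := qnorm (set_val (d : set_type (orbit_disc A))).

Lemma dnorm_le1 d : dnorm d <= 1.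
Proof. exact/orbit_discE/(set_valP (d : set_type (orbit_disc A))). Qed.

Lemma dnorm_ge0 d : 0 <= dnorm d.
Proof. exact: qnorm_ge0. Qed.

Lemma dnorm_continuous : continuous dnorm.
Proof.
apply: continuousT_comp; last exact: qnorm_continuous.
exact: set_val_continuous.
Qed.

Lemma dsphereE d : iset_set (psub DP) d <-> dnorm d = 1.
Proof. exact: orbit_sphereE. Qed.

Section Push.
Variable phi : R * R -> R.
Hypothesis phi_continuous : continuous phi.
Hypothesis phi_bound : forall t r : R, 0 <= r <= 1 -> `|phi (t, r)| * r <= 1.

Lemma dpush_subproof (td : R * D) : iset_set (orbit_disc A)
  (qscale (phi (td.1, dnorm td.2)) (set_val (td.2 : set_type (orbit_disc A)))).
Proof.
apply/orbit_discE; rewrite qnorm_scale; apply: phi_bound.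
by rewrite dnorm_ge0 dnorm_le1.
Qed.

(** Radial scaling by a factor depending on time and norm. One construction serves both the collar
    of the sphere bundle and the contraction to the zero section. *)
Definition dpush (td : R * D) : D :=
  exist (fun q => is_true (q \in iset_set (orbit_disc A))) _
    (mem_set (dpush_subproof td)).

Lemma dpush_val t d : set_val (dpush (t, d) : set_type (orbit_disc A)) =
  qscale (phi (t, dnorm d)) (set_val (d : set_type (orbit_disc A))).
Proof. by []. Qed.

Lemma dpush_continuous : continuous dpush.
Proof.
apply: continuous_into_sub.
apply: (@continuousT_comp _ _ _
  (fun td : R * D =>
    (phi (td.1, dnorm td.2), set_val (td.2 : set_type (orbit_disc A))))
  (fun rq : R * orbit_gspace A => qscale rq.1 rq.2));
  last exact: qscale_continuous.
apply: continuous_pair.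
  apply: (@continuousT_comp _ _ _
    (fun td : R * D => (td.1, dnorm td.2)) phi) => //.
  apply: continuous_pair; first by move=> x; exact: cvg_fst.
  apply: (@continuousT_comp _ _ _ snd); last exact: dnorm_continuous.
  by move=> x; exact: cvg_snd.
apply: (@continuousT_comp _ _ _ snd); last exact: set_val_continuous.
by move=> x; exact: cvg_snd.
Qed.

Lemma dnorm_act g d : dnorm (gact g d) = dnorm d.
Proof. exact: qnorm_act. Qed.

Lemma dpush_equivariant t g d : dpush (t, gact g d) = gact g (dpush (t, d)).
Proof.
apply: val_inj => /=; rewrite -[LHS]/(qscale _ (gact g _)) qscale_act.
by rewrite -[dnorm (gsub_act _ _)]/(dnorm (gact g d)) dnorm_act.
Qed.

Lemma dnorm_push t d : dnorm (dpush (t, d)) = `|phi (t, dnorm d)| * dnorm d.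
Proof. by rewrite /dnorm dpush_val qnorm_scale. Qed.

Lemma dpush_id t d : phi (t, dnorm d) = 1 -> dpush (t, d) = d.
Proof. by move=> e; apply: val_inj; rewrite [LHS]dpush_val e qscale1. Qed.

End Push.

End OrbitMaps.

(** * The two radial factors *)

Section RadialFactors.
Variable R : realType.

(** For norms [r <= 1]: the first term starts at 1 and makes the factor grow with time; the second
    is a cap keeping the norm at most 1, cut off at 1/2 to avoid the pole at [r = 0]. At [r = 1] the
    cap is 1, so the sphere is fixed. At time 1 the first term is 2, so for [r > 1/2] the factor is
    [1/r] and the point reaches the sphere. *)
Definition expansion (tr : R * R) : R :=
  Num.min (1 + Num.max tr.1 0) (Num.max tr.2 2^-1)^-1.

(** Time clamped to the unit interval, since it ranges over all of [R]; the norm does not enter. *)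
Definition contraction (tr : R * R) : R := Num.max 0 (Num.min tr.1 1).

Let max_gt0 (r : R) : 0 < Num.max r 2^-1.
Proof. by rewrite lt_max invr_gt0 ltr0n orbT. Qed.

Let half_le1 : 2^-1 <= 1 :> R.
Proof. by rewrite invf_le1 ?ler1n. Qed.

Lemma expansion_continuous : continuous expansion.
Proof.
move=> tr; have c1 : {for tr, continuous (fst : R * R -> R)} by exact: cvg_fst.
have c2 : {for tr, continuous (snd : R * R -> R)} by exact: cvg_snd.
have cc (a : R) : {for tr, continuous (fun _ : R * R => a)} by exact: cvg_cst.
apply: (@continuous_min _ _ (fun tr : R * R => 1 + Num.max tr.1 0)
  (fun tr : R * R => (Num.max tr.2 2^-1)^-1)).
  apply: (@continuousD _ R^o _ (fun=> 1)
    (fun tr : R * R => Num.max tr.1 0)) => //.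
  exact: (@continuous_max _ _ fst (fun=> 0)).
apply: (@continuousV _ _ (fun tr : R * R => Num.max tr.2 2^-1)).
  by rewrite gt_eqF.
exact: (@continuous_max _ _ snd (fun=> 2^-1)).
Qed.

Lemma contraction_continuous : continuous contraction.
Proof.
move=> tr; have c1 : {for tr, continuous (fst : R * R -> R)} by exact: cvg_fst.
have cc (a : R) : {for tr, continuous (fun _ : R * R => a)} by exact: cvg_cst.
apply: (@continuous_max _ _ (fun=> 0) (fun tr : R * R => Num.min tr.1 1)) => //.
exact: (@continuous_min _ _ fst (fun=> 1)).
Qed.

Lemma contraction_bound (t r : R) :
  0 <= r <= 1 -> `|contraction (t, r)| * r <= 1.
Proof.
move=> /andP[r0 r1]; rewrite mulr_ile1 // /contraction /=.
by rewrite ger0_norm ?le_max ?lexx // ge_max ler01 ge_min lexx orbT.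
Qed.

Lemma contraction0 (r : R) : contraction (0, r) = 0.
Proof. by rewrite /contraction /= (min_l ler01) maxxx. Qed.

Lemma contraction1 (r : R) : contraction (1, r) = 1.
Proof. by rewrite /contraction /= minxx (max_r ler01). Qed.

Lemma expansion_ge1 (t r : R) : r <= 1 -> 1 <= expansion (t, r).
Proof.
move=> r1; rewrite /expansion le_min /= lerDl le_max lexx orbT /=.
by rewrite invf_ge1 // ge_max r1 half_le1.
Qed.

Lemma expansion_bound (t r : R) : 0 <= r <= 1 -> `|expansion (t, r)| * r <= 1.
Proof.
move=> /andP[r0 r1]; rewrite ger0_norm ?(le_trans ler01) ?expansion_ge1 //.
apply: (@le_trans _ _ ((Num.max r 2^-1)^-1 * r)).
  by apply: ler_wpM2r => //; rewrite /expansion ge_min lexx orbT.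
by rewrite ler_pdivrMl // mulr1 le_max lexx.
Qed.

Lemma expansion0 (r : R) : r <= 1 -> expansion (0, r) = 1.
Proof.
move=> r1; apply/eqP; rewrite eq_le expansion_ge1 // andbT.
by rewrite /expansion ge_min /= maxxx addr0 lexx.
Qed.

Lemma expansion_unit (t : R) : expansion (t, 1) = 1.
Proof.
apply/eqP; rewrite eq_le expansion_ge1 // andbT /expansion ge_min /=.
by rewrite (max_l half_le1) invr1 lexx orbT.
Qed.

Lemma expansion1 (r : R) : 2^-1 < r -> expansion (1, r) = r^-1.
Proof.
move=> r2; have r0 : 0 < r by apply: lt_trans r2; rewrite invr_gt0.
rewrite /expansion /= (max_l (ltW r2)) max_l ?ler01 // min_r //.
by rewrite -[leRHS]invrK lef_pV2 ?posrE ?invr_gt0 // ltW.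
Qed.

End RadialFactors.

(** * Deformations of the orbit disc bundle *)

Section OrbitDisc.
Context {R : realType} {G : topGroupType} {B : gspace G} {V : cvbundle R B}.
Variable A : linear_action V.
Local Notation DP := (orbit_disc_pair A).
Local Notation D := (psp DP).

Lemma dcollar_inv g (d : D) : 2^-1 < dnorm d -> 2^-1 < dnorm (gact g d).
Proof. by rewrite dnorm_act. Qed.

Definition dcollar_nbhs : iset D :=
  @ISet _ D [set d | 2^-1 < dnorm d] dcollar_inv.

Program Definition dcollar : collar R DP :=
  @Collar R G DP dcollar_nbhs
    (@dpush R G B V A (@expansion R) (@expansion_bound R)) _ _ _ _ _ _ _ _ _.
Next Obligation. by move=> d /dsphereE /= ->; rewrite invf_lt1 ?ltr1n. Qed.
Next Obligation.
rewrite (_ : iset_set _ = dnorm (A := A) @^-1` [set 1]).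
  have /continuous_closedP := @dnorm_continuous _ _ _ _ A; apply.
  exact: closed_eq.
by apply/seteqP; split=> d /dsphereE.
Qed.
Next Obligation.
have /continuousP := @dnorm_continuous _ _ _ _ A.
by move=> /(_ [set r | 2^-1 < r]); apply; exact: open_gt.
Qed.
Next Obligation. by apply: dpush_continuous; exact: expansion_continuous. Qed.
Next Obligation. by move=> t g d; exact: dpush_equivariant. Qed.
Next Obligation.
by move=> d; apply: dpush_id; rewrite expansion0 ?dnorm_le1.
Qed.
Next Obligation.
by move=> t d /dsphereE d1; apply: dpush_id; rewrite d1 expansion_unit.
Qed.
Next Obligation.
move=> d d2; apply/dsphereE; rewrite dnorm_push expansion1 //.
have d0 : 0 < dnorm d by apply: lt_trans d2; rewrite invr_gt0.
by rewrite gtr0_norm ?invr_gt0 // mulVf ?gt_eqF.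
Qed.
Next Obligation.
move=> t d /= d2; apply: (lt_le_trans d2); rewrite dnorm_push.
have h := expansion_ge1 t (dnorm_le1 d).
by rewrite ger0_norm ?(le_trans ler01) // ler_peMl ?dnorm_ge0.
Qed.

Lemma orbit_disc_proj_zero b : orbit_disc_proj A (orbit_zero A b) = b.
Proof.
rewrite /= -[LHS]/(orbit_proj A (orbit_fun A _)) orbit_proj_pi.
exact: vb_proj_zero.
Qed.

(** Scaling by the time parameter goes from the projection onto the zero section at time 0 to the
    identity at time 1. *)
Lemma orbit_zero_proj_homotopic :
  homotopic R (abs_map (gcomp (orbit_zero A) (orbit_disc_proj A)))
    (pid (abs D)).
Proof.
exists (@dpush R G B V A (@contraction R) (@contraction_bound R)); split=> //.
- apply: continuous_subspaceT; apply: dpush_continuous.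
  exact: contraction_continuous.
- move=> d; apply: val_inj.
  rewrite [LHS](dpush_val (@contraction_bound R)) contraction0.
  exact: qscale0.
- by move=> d; apply: dpush_id; exact: contraction1.
- by move=> t d g _; exact: dpush_equivariant.
Qed.

Context {E : cohomology_theory R G}.

Lemma gpull_zeroK (x : coh E (abs D)) :
  gpull (orbit_disc_proj A) (gpull (orbit_zero A) x) = x.
Proof.
rewrite (gpull_comp_ext (k := gcomp (orbit_zero A) (orbit_disc_proj A))) //.
by rewrite /gpull (pull_homotopic x orbit_zero_proj_homotopic) pull_id.
Qed.

Lemma gpull_projK (x : coh E (abs B)) :
  gpull (orbit_zero A) (gpull (orbit_disc_proj A) x) = x.
Proof.
rewrite (gpull_comp_ext (k := gid B)).
  by rewrite -[RHS]pull_id; exact: pull_ext.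
exact: orbit_disc_proj_zero.
Qed.

Definition sphere_proj : gmap (gsub (psub DP)) B :=
  gcomp (orbit_disc_proj A) (gsub_incl (psub DP)).

Section Normalize.
Variables (T : gspace G) (q : gmap T (orbit_gspace A)).
Hypothesis q0 : forall x, qnorm (q x) != 0.

Let nq (x : T) := qscale (qnorm (q x))^-1 (q x).

Let qnorm_nq x : qnorm (nq x) = 1.
Proof.
by rewrite qnorm_scale normrV ?unitfE // ger0_norm ?qnorm_ge0 // mulVf.
Qed.

Let nq_continuous : continuous nq.
Proof.
apply: (@continuousT_comp _ _ _ (fun x => ((qnorm (q x))^-1, q x))
  (fun rq : R * orbit_gspace A => qscale rq.1 rq.2));
  last exact: qscale_continuous.
apply: continuous_pair; last exact: gfun_continuous.
move=> x; apply: (@continuousV _ _ (fun x => qnorm (q x))) => //.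
apply: (@continuousT_comp _ _ _ q (@qnorm _ _ _ _ A)).
  exact: gfun_continuous.
exact: qnorm_continuous.
Qed.

Let nq_equivariant g x : nq (gact g x) = gact g (nq x).
Proof. by rewrite /nq gfun_equivariant qnorm_act qscale_act. Qed.

Let nqmap : gmap T (orbit_gspace A) := GMap nq_continuous nq_equivariant.

Let nq_disc x : iset_set (orbit_disc A) (nqmap x).
Proof. by apply/orbit_discE; rewrite qnorm_nq. Qed.

Let nq_sphere x : iset_set (psub DP) (gcorestrict nq_disc x).
Proof. by apply/dsphereE; exact: qnorm_nq. Qed.

(** A nowhere zero map to V/A is divided by its norm, which does not move the base point. This
    transfers vanishing on the sphere bundle to all nonzero vectors. *)
Lemma normalize_exists : exists n : gmap T (gsub (psub DP)),
  forall x, sphere_proj (n x) = orbit_proj A (q x).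
Proof.
exists (gcorestrict nq_sphere) => x.
exact: orbit_proj_scale.
Qed.

End Normalize.

End OrbitDisc.

(** * Euler classes *)

Section EulerClass.
Context {R : realType} {G : topGroupType} {E : cohomology_theory R G}.
Variable eta : thom_classes E.

Section OneBundle.
Context {B : gspace G} (xi : sob E B).
Hypothesis gcwB : finite_gcw R B.
Local Notation A := (sob_action xi).
Local Notation DP := (thom_pair xi).
Local Notation e := (euler_class eta xi).

Definition zero_map : pmap (abs B) DP := @from_abs G B DP (orbit_zero A).

Lemma gpull_zero_rel (y : coh E DP) :
  gpull (orbit_zero A) (pull E (rel_map DP) y) = pull E zero_map y.
Proof. exact: pull_comp_ext. Qed.

Lemma euler_homogeneous : homogeneous (vb_rank xi).*2%:Z e.
Proof.
have [he _] := orb_thomP eta xi gcwB.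
by rewrite /homogeneous -pull_hcomp he.
Qed.

Lemma euler_comm (x : coh E (abs B)) : cupr e x = cupr x e.
Proof. exact: cupr_even_comm euler_homogeneous. Qed.

Definition thom_cup (c : coh E (abs B)) : coh E DP :=
  cupm (gpull (orbit_disc_proj A) c) (orb_thom eta xi).

Lemma thom_cup_surj (y : coh E DP) : exists c, y = thom_cup c.
Proof.
have [_ [h _ hK]] := orb_thomP eta xi gcwB.
by exists (h y); rewrite -[LHS]hK.
Qed.

Lemma zero_thom_cup c : pull E zero_map (thom_cup c) = cupr c e.
Proof.
rewrite -[in RHS](gpull_projK A c).
exact: (@cup_natural R G E B (psp DP) (iset0 B) (iset0 B) (iset0 B)).
Qed.

(** The Gysin argument: by exactness the pullback of [a] to the disc bundle dies on the sphere
    bundle if and only if it lifts to a relative class. By the Thom isomorphism such a class is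
    [thom_cup c], which restricts to [c e] on the zero section. *)
Lemma euler_dividesP (a : coh E (abs B)) :
  cdivides e a <-> gpull (sphere_proj A) a = 0.
Proof.
have -> : gpull (sphere_proj A) a =
    gpull (gsub_incl (psub DP)) (gpull (orbit_disc_proj A) a).
  by symmetry; exact: gpull_comp_ext.
split=> [[c ->]|/exact_spaceP[y ay]].
  rewrite euler_comm -zero_thom_cup -gpull_zero_rel gpull_zeroK.
  exact: pull_rel_sub.
have [c yc] := thom_cup_surj y; exists c.
by rewrite euler_comm -zero_thom_cup -yc -gpull_zero_rel -ay gpull_projK.
Qed.

(** Since [e] divides itself it pulls back to zero on the sphere bundle, and the normalised [q]
    factors the map to [B] through that bundle. *)
Lemma euler_vanishes (T : gspace G) (q : gmap T (orbit_gspace A)) :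
  (forall x, qnorm (q x) != 0) -> gpull (gcomp (orbit_proj A) q) e = 0.
Proof.
move=> q0; have [n nE] := normalize_exists q0.
have /euler_dividesP e0 : cdivides e e.
  by exists (coh1 E B); rewrite euler_comm cup1r.
rewrite -(gpull0 n) -e0; symmetry; exact: gpull_comp_ext.
Qed.

(** By the Thom isomorphism [y] is [thom_cup c]; restriction to the zero section turns it into
    [c e], where [c] can be cancelled to zero. *)
Lemma pull_rel_thom_inj (y : coh E DP) :
  (forall c, cupr c e = 0 -> c = 0) -> pull E (rel_map DP) y = 0 -> y = 0.
Proof.
move=> reg y0; have [c yc] := thom_cup_surj y.
have c0 : c = 0.
  by apply: reg; rewrite -zero_thom_cup -yc -gpull_zero_rel y0 gpull0.
have [_ [h hK _]] := orb_thomP eta xi gcwB.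
rewrite yc c0; apply: (@addrI _ (thom_cup 0)); rewrite addr0.
have := @cup_linear_l R G E _ (iset0 (psp DP)) (psub DP) (psub DP)
  (@excisive0 _ (psub DP)) (esym (set0U _)) 1 0 0 (orb_thom eta xi).
by rewrite !scale1r addr0 /thom_cup gpull0 => <-.
Qed.

End OneBundle.

(** * Euler classes of decomposed bundles *)

Section Decomposition.
Context {B : gspace G} {I : finType} (V : sob E B) (W : I -> sob E B).
Hypothesis gcwB : finite_gcw R B.
Variable D : decomposition V W.
Local Notation AV := (sob_action V).
Local Notation AW s := (sob_action (W s)).

Lemma dc_proj_zero s b : dc_proj D s (vb_zero V b) = vb_zero (W s) b.
Proof.
have [hp _ hs] := dc_proj_linear D s.
by rewrite -{1}[b](vb_proj_zero V) -vb_scale0 hs vb_scale0 hp vb_proj_zero.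
Qed.

Lemma dc_incl_zero s b : dc_incl D s (vb_zero (W s) b) = vb_zero V b.
Proof.
have [hp _ hs] := dc_incl_linear D s.
by rewrite -{1}[b](vb_proj_zero (W s)) -vb_scale0 hs vb_scale0 hp vb_proj_zero.
Qed.

Lemma dc_proj_orbit s v v' : orbit_fun AV v = orbit_fun AV v' ->
  gcomp (orbit_pi (AW s)) (dc_proj D s) v =
  gcomp (orbit_pi (AW s)) (dc_proj D s) v'.
Proof.
move=> /orbit_funP[a ->]; apply/orbit_funP; exists (dc_quot D s a).
exact: dc_quot_act.
Qed.

(* A lift to A of an element of A_s maps the summand W_s to itself. *)
Lemma dc_incl_orbit s w w' : orbit_fun (AW s) w = orbit_fun (AW s) w' ->
  gcomp (orbit_pi AV) (dc_incl D s) w = gcomp (orbit_pi AV) (dc_incl D s) w'.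
Proof.
move=> /orbit_funP[c ->]; have [a <-] := @dc_quot_surj _ _ _ _ _ _ _ D s c.
apply/orbit_funP; exists a.
have [ip _ _] := dc_incl_linear D s; have [ap _ _] := la_linear a.
have [cp _ _] := la_linear (dc_quot D s a).
apply: (@dc_inj _ _ _ _ _ _ _ D) => [|t]; first by rewrite ip cp ap ip.
rewrite dc_quot_act.
have [->|ts] := eqVneq t s; first by rewrite !dc_inclK.
have [tp _ tZ] := la_linear (dc_quot D t a).
rewrite !dc_incl_proj0 // cp.
rewrite -{2}[vb_proj _ w](vb_proj_zero (W t)) -vb_scale0 tZ vb_scale0 tp.
by rewrite vb_proj_zero.
Qed.

Definition qproj s : gmap (orbit_gspace AV) (orbit_gspace (AW s)) :=
  orbit_desc (@dc_proj_orbit s).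

Definition qincl s : gmap (orbit_gspace (AW s)) (orbit_gspace AV) :=
  orbit_desc (@dc_incl_orbit s).

Lemma qproj_pi s v :
  qproj s (orbit_fun AV v) = orbit_fun (AW s) (dc_proj D s v).
Proof. exact: (orbit_desc_pi (@dc_proj_orbit s)). Qed.

Lemma qincl_pi s w :
  qincl s (orbit_fun (AW s) w) = orbit_fun AV (dc_incl D s w).
Proof. exact: (orbit_desc_pi (@dc_incl_orbit s)). Qed.

Lemma orbit_proj_qproj s q : orbit_proj (AW s) (qproj s q) = orbit_proj AV q.
Proof.
have [hp _ _] := dc_proj_linear D s.
by rewrite -[q]orbit_fun_repr qproj_pi !orbit_proj_pi hp.
Qed.

(** A vector is determined by its components, so one whose components all vanish is zero and cannot
    have norm 1. *)
Lemma qproj_neq0 q : qnorm q = 1 -> exists s, qnorm (qproj s q) != 0.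
Proof.
rewrite -[q]orbit_fun_repr; move: (orbit_repr q) => v; rewrite qnorm_pi => v1.
apply: contrapT => h; suff v0 : v = vb_zero V (vb_proj V v).
  have v00 : v = vb_scale (toC 0) v by rewrite [toC 0](_ : _ = 0) // vb_scale0.
  by move/eqP: v1; rewrite v00 vnorm_scale normr0 mul0r eq_sym oner_eq0.
apply: (@dc_inj _ _ _ _ _ _ _ D) => [|s]; first by rewrite vb_proj_zero.
have [hp _ _] := dc_proj_linear D s.
rewrite dc_proj_zero -(hp v); apply: vnorm_eq0; apply/eqP.
rewrite -[_ == 0]negbK; apply/negP => ns; apply: h; exists s.
by rewrite qproj_pi qnorm_pi.
Qed.

Lemma qnorm_qincl s q : qnorm (qincl s q) = qnorm q.
Proof.
rewrite -[q]orbit_fun_repr qincl_pi !qnorm_pi.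
by apply: vnorm_isometric; exact: dc_incl_isometric.
Qed.

Lemma qincl_disc s q :
  iset_set (orbit_disc (AW s)) q -> iset_set (orbit_disc AV) (qincl s q).
Proof. by rewrite !orbit_discE qnorm_qincl. Qed.

Definition dincl s : gmap (psp (thom_pair (W s))) (psp (thom_pair V)) :=
  grestrict (@qincl_disc s).

Lemma dincl_zero s b : dincl s (orbit_zero (AW s) b) = orbit_zero AV b.
Proof.
apply: val_inj; rewrite /= -[LHS]/(qincl s (orbit_fun _ _)) qincl_pi /=.
by rewrite dc_incl_zero.
Qed.

Local Notation SV := (gsub (psub (thom_pair V))).

Definition sphere_qproj s : gmap SV (orbit_gspace (AW s)) :=
  gcomp (qproj s)
    (gcomp (gsub_incl (orbit_disc AV)) (gsub_incl (psub (thom_pair V)))).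

Lemma nonzero_inv s g (x : SV) : qnorm (sphere_qproj s x) != 0 ->
  qnorm (sphere_qproj s (gact g x)) != 0.
Proof. by rewrite gfun_equivariant qnorm_act. Qed.

Definition nonzero_set s : iset SV :=
  @ISet _ SV [set x | qnorm (sphere_qproj s x) != 0] (@nonzero_inv s).

Lemma nonzero_set_open s : open (iset_set (nonzero_set s)).
Proof.
have c : continuous (fun x : SV => qnorm (sphere_qproj s x)).
  apply: (@continuousT_comp _ _ _ (sphere_qproj s) (@qnorm _ _ _ _ (AW s))).
    exact: gfun_continuous.
  exact: qnorm_continuous.
by move/continuousP: c => /(_ [set r | r != 0]); apply; exact: open_neq.
Qed.

(** By [euler_dividesP] the product only has to vanish on S(V/A). The open sets [nonzero_set s]
    cover it, and over each of them the component [s] is a nowhere zero map, which kills the factor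
    of index [s]. *)
Lemma euler_divides_prod : cdivides (euler_class eta V)
  (cuprod (fun s => euler_class eta (W s)) (enum I)).
Proof.
apply/euler_dividesP => //; rewrite gpull_cuprod.
apply: (@vanishes_on_setT _ _ _ _ (iset_cover nonzero_set (enum I))).
  apply/seteqP; split=> // x _; apply/iset_coverP.
  have [|s sx] := @qproj_neq0 (set_val (set_val x : set_type (orbit_disc AV))).
    by apply/dsphereE; exact: (set_valP x).
  by exists s; rewrite ?mem_enum.
apply: cuprod_vanishes => s; first exact: nonzero_set_open.
rewrite /vanishes_on.
rewrite (gpull_comp_ext (k := gcomp (orbit_proj (AW s))
  (gcomp (sphere_qproj s) (gsub_incl (nonzero_set s))))).
  by apply: euler_vanishes => // x; exact: (set_valP x).
by move=> x; symmetry; exact: orbit_proj_qproj.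
Qed.

(** By [euler_dividesP] both terms are compared on the sphere bundle of [W s], where each becomes
    the pullback of [y] along [chi]. *)
Lemma euler_divides_restriction (Z C : gspace G) s
    (chi : gmap (psp (thom_pair V)) Z) (f : gmap B C) (i : gmap C Z)
    (y : coh E (abs Z)) :
  attaches_along chi (dc_incl D s) f i ->
  cdivides (euler_class eta (W s))
    (gpull (gcomp chi (orbit_zero AV)) y - gpull f (gpull i y)).
Proof.
move=> att; apply/euler_dividesP => //; rewrite gpullB.
apply/eqP; rewrite subr_eq0; apply/eqP.
have -> : gpull (gcomp chi (orbit_zero AV)) y =
    gpull (orbit_zero (AW s)) (gpull (gcomp chi (dincl s)) y).
  symmetry; apply: gpull_comp_ext => b.
  by rewrite /= -[X in chi X]/(dincl s (orbit_zero (AW s) b)) dincl_zero.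
(* On the disc bundle, restricting to the zero section and pulling back along the projection is the
   identity, so only [chi] on the sphere remains. *)
have -> : gpull (sphere_proj (AW s)) (gpull (orbit_zero (AW s))
      (gpull (gcomp chi (dincl s)) y)) =
    gpull (gcomp (gcomp chi (dincl s)) (gsub_incl (psub (thom_pair (W s))))) y.
  rewrite -(gpull_comp_ext (f := orbit_disc_proj (AW s))
    (h := gsub_incl (psub (thom_pair (W s))))) //.
  by rewrite gpull_zeroK; exact: gpull_comp_ext.
rewrite (gpull_comp_ext (f := f) (k := gcomp f (sphere_proj (AW s)))) //.
rewrite (gpull_comp_ext (f := i)
  (k := gcomp i (gcomp f (sphere_proj (AW s))))) //.
apply: gpull_ext => x /=.
(* A representative of a point of the sphere bundle has norm 1, as the attaching condition
   requires. *)
pose w := orbit_repr (set_val (set_val x : set_type (orbit_disc (AW s)))).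
apply: (att w); last by [].
apply/vnorm_sphere.
have /dsphereE := set_valP x.
by [].
Qed.

End Decomposition.
End EulerClass.

(** * Extension over the strata *)

(** Allows a stratum X_{j+1} to be taken as the ambient space, as the results on attached pairs
    demand. *)
Lemma attached_corestrict (G : topGroupType) (X P : gspace G) (Y A : iset X)
    (S : iset P) (chi : gmap P X) (h : forall d, iset_set A (chi d)) :
  attached (iset_set Y) (iset_set A) (iset_set S) chi ->
  attached (iset_set (isetI_pre (gsub_incl A) Y)) setT (iset_set S)
    (gcorestrict h).
Proof.
move=> [cY YA cS [cb ci cs] top]; split=> //.
- have /continuous_closedP := @set_val_continuous _ _ A; apply; exact: cY.
- by move=> _ [d Sd <-]; apply: cS; exists d.
- split.
  + by move=> d nSd; have [_ nY] := cb d nSd.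
  + by move=> d d' nSd nSd' /(congr1 set_val) /=; exact: ci.
  + move=> z [_ nYz]; have [|d nSd dz] := cs (set_val z).
      by split=> //; exact: set_valP.
    by exists d => //; exact: val_inj.
move=> Z _ cZY cZ.
rewrite (_ : Z = set_val @^-1` (set_val @` Z)); last first.
  apply/seteqP; split=> [z Zz|z [z' Zz' /val_inj <-] //]; first by exists z.
have /continuous_closedP := @set_val_continuous _ _ A; apply.
apply: top => [_ [z _ <-]||]; first exact: set_valP.
  (* The complement in [A] of the closed trace is cut out by an open [Q] of [X], so the trace is [Y]
     minus [Q], which is closed in [X]. *)
  move: cZY; rewrite -openC => -[Q oQ QE].
  rewrite (_ : _ `&` _ = ~` Q `&` iset_set Y).
    by apply: closedI => //; exact: open_closedC.
  apply/seteqP; split=> [_ [[z Zz <-] Yz]|x [nQx Yx]].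
    split=> // Qz; have : (set_val @^-1` Q) z by [].
    by rewrite QE => nn; apply: nn.
  pose z : gsub A := exist _ x (mem_set (YA x Yx)).
  split=> //; exists z => //; apply: contrapT => nZz; apply: nQx.
  suff : (set_val @^-1` Q) z by [].
  by rewrite QE => -[].
rewrite (_ : _ @^-1` _ = gcorestrict h @^-1` Z) //.
apply/seteqP; split=> [d [z Zz zd]|d Zd]; last by exists (gcorestrict h d).
by rewrite /= (_ : exist _ _ _ = z) //; exact: val_inj.
Qed.

Section Extension.
Context {R : realType} {G : topGroupType} {E : cohomology_theory R G}.
Variable eta : thom_classes E.
Context {B : gspace G} (V : sob E B).
Hypothesis gcwB : finite_gcw R B.
Hypothesis regular : forall c, cupr c (euler_class eta V) = 0 -> c = 0.

Variables (Z : gspace G) (Y : iset Z) (chi : gmap (psp (thom_pair V)) Z).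
Hypothesis att : attached (iset_set Y) setT (iset_set (psub (thom_pair V))) chi.

Let chi_sub d : iset_set (psub (thom_pair V)) d -> iset_set Y (chi d).
Proof. by move=> Sd; have [_ _ h _ _] := att; apply: h; exists d. Qed.

Let chip : pmap (thom_pair V) (GPair Y) :=
  @PMap _ (thom_pair V) (GPair Y) chi chi_sub.

Let chip_bij : bijective (pull E chip).
Proof.
exact: (@pull_attached_bij _ _ _ (thom_pair V) (dcollar (sob_action V)) _ _
  chip att).
Qed.

(* The connecting map vanishes on Y because it does so on S(V/A), the Thom class
   of V/A having a regular restriction to the zero section. *)
Lemma extends_over_cell (y : coh E (abs (gsub Y))) :
  exists z, gpull (gsub_incl Y) z = y.
Proof.
suff : [set x | delta E (GPair Y) x = 0] y.
  by rewrite exact_sub => -[z _ <-]; exists z.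
apply: (bij_inj chip_bij); rewrite raddf0 delta_natural.
apply: (@pull_rel_thom_inj _ _ _ eta _ V gcwB) => //.
set x := pull E (pmap_sub chip) y.
have : range (delta E (thom_pair V)) (delta E (thom_pair V) x) by exists x.
by rewrite -exact_pair.
Qed.

(** For [x = e c], the class [thom_cup c] is carried to E(Z, Y) by the inverse of the isomorphism
    induced by [chi]; its image in E(Z) vanishes on [Y] and restricts to [c e] on the zero
    section. *)
Lemma corrected_over_cell (x : coh E (abs B)) :
  cdivides (euler_class eta V) x ->
  exists2 z, gpull (gsub_incl Y) z = 0 &
    gpull (gcomp chi (orbit_zero (sob_action V))) z = x.
Proof.
move=> [c ->]; have [f _ fK] := chip_bij.
exists (pull E (rel_map (GPair Y)) (f (thom_cup eta V c))).
  exact: (@pull_rel_sub _ _ _ (GPair Y)).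
rewrite (euler_comm eta V gcwB) -(zero_thom_cup eta V).
rewrite -[in RHS](fK (thom_cup eta V c)).
by rewrite /gpull -!pull_comp; exact: pull_ext.
Qed.

End Extension.

(** * Induction over the strata *)

Section Stratification.
Context {R : realType} {G : topGroupType} {E : cohomology_theory R G}.
Context {X : gspace G} {l : nat} (K : orbifold_stratification E X l).

Lemma os_char_filt (j : 'I_l) d : iset_set (os_filt K j.+1) (os_char K j d).
Proof.
have [_ sub cS [cb _ _] _] := os_attached K j.
have [Sd|nSd] := pselect (iset_set (psub (thom_pair (os_bundle K j))) d).
  by apply: sub; apply: cS; exists d.
by have [] := cb d nSd.
Qed.

Lemma os_filt_le (i k : nat) : (i <= k <= l)%N ->
  iset_set (os_filt K i) `<=` iset_set (os_filt K k).
Proof.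
elim: k => [|k IH] /andP[].
  by rewrite leqn0 => /eqP -> _; exact: subset_refl.
rewrite leq_eqVlt => /predU1P[-> _|ik kl]; first exact: subset_refl.
apply: subset_trans (IH _) _; first by rewrite -ltnS ik ltnW.
by have [_ + _ _ _] := os_attached K (Ordinal kl).
Qed.

Lemma os_incl_filt (i : 'I_l) (k : nat) b : (i < k <= l)%N ->
  iset_set (os_filt K k) (os_incl K i b).
Proof. by move=> ikl; apply: (os_filt_le ikl); exact: os_char_filt. Qed.

(** Quantifying over every factorisation [g] of the inclusion of B_i through X_k avoids carrying a
    chosen proof that B_i lies in X_k. *)
Definition restricts_to (x : forall j : 'I_l, coh E (abs (os_base K j)))
    (k : nat) (y : coh E (abs (gsub (os_filt K k)))) : Prop :=
  forall (i : 'I_l) (g : gmap (os_base K i) (gsub (os_filt K k))),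
    (i < k)%N ->
    (forall b, set_val (g b : set_type (os_filt K k)) = os_incl K i b) ->
    gpull g y = x i.

Variable eta : thom_classes E.
Variable W : forall (j : 'I_l) (s : below j), sob E (os_base K j).
Variable D : forall j : 'I_l, (0 < j)%N ->
  decomposition (os_bundle K j) (@W j).
Variable f : forall (j : 'I_l) (s : below j),
  gmap (os_base K j) (os_base K (sval s)).
Hypothesis A2 : forall (j : 'I_l) (hj : (0 < j)%N) (s : below j),
  attaches_along (os_char K j) (dc_incl (D hj) s) (f s) (os_incl K (sval s)).
Hypothesis A3_regular : forall (j : 'I_l) (s : below j),
  nonzerodivisor (euler_class eta (W s)).
Hypothesis A3_coprime : forall (j : 'I_l) (s t : below j), s != t ->
  relatively_prime (euler_class eta (W s)) (euler_class eta (W t)).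

Lemma os_euler_divides_prod (j : 'I_l) :
  cdivides (euler_class eta (os_bundle K j))
    (cuprod (fun s : below j => euler_class eta (W s)) (enum (below j))).
Proof.
have gcwB := os_base_gcw K j.
have [j0|hj] := posnP j; last exact: euler_divides_prod gcwB (D hj).
(* The bottom stratum is attached to the empty set, so its sphere is empty. *)
apply/euler_dividesP => //; set a := gpull _ _.
apply: (vanishes_on_setT _ (vanishes_on_iset0 a)).
apply/seteqP; split=> // x _ /=.
have [_ _ cS _ _] := os_attached K j.
have : iset_set (os_filt K j) (os_char K j (set_val x)).
  by apply: cS; exists (set_val x) => //; exact: set_valP.
by rewrite j0 os_filt0.
Qed.

(** A class killing the Euler class also kills its multiple, the product of the Euler classes of the
    components, and that product is regular. *)
Lemma os_euler_regular (j : 'I_l) (c : coh E (abs (os_base K j))) :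
  cupr c (euler_class eta (os_bundle K j)) = 0 -> c = 0.
Proof.
move=> c0; apply: (@cuprod_regular _ _ _ _ _
  (fun s : below j => euler_class eta (W s)) (enum (below j))) => //.
by have [d ->] := os_euler_divides_prod j; rewrite cuprA c0 cup0r.
Qed.

Variable x : forall j : 'I_l, coh E (abs (os_base K j)).
Hypothesis Gx : forall (j : 'I_l) (s : below j),
  cdivides (euler_class eta (W s)) (x j - gpull (f s) (x (sval s))).

Lemma restricts_toS (j : 'I_l) :
  (exists y, restricts_to x (k := j) y) ->
  exists y, restricts_to x (k := j.+1) y.
Proof.
move=> [y yx].
have gcwB := os_base_gcw K j.
(* [Y] is X_j seen inside X_{j+1}; the map [r] below compares it with X_j as a subspace of [X]. *)
pose Y := isetI_pre (gsub_incl (os_filt K j.+1)) (os_filt K j).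
pose chi : gmap _ (gsub (os_filt K j.+1)) := gcorestrict (@os_char_filt j).
have att : attached (iset_set Y) setT
    (iset_set (psub (thom_pair (os_bundle K j)))) chi.
  by apply: attached_corestrict; exact: os_attached.
have hr (z : gsub Y) : iset_set (os_filt K j)
    (gcomp (gsub_incl (os_filt K j.+1)) (gsub_incl Y) z) by exact: (set_valP z).
pose r : gmap (gsub Y) (gsub (os_filt K j)) := gcorestrict hr.
have [z zy] :=
  extends_over_cell gcwB (os_euler_regular (j := j)) att (gpull r y).
have lower (i : 'I_l) (g : gmap (os_base K i) (gsub (os_filt K j.+1))) :
    (i < j)%N ->
    (forall b, set_val (g b : set_type (os_filt K j.+1)) = os_incl K i b) ->
    exists2 g' : gmap (os_base K i) (gsub Y),
      gpull g' (gpull r y) = x i & gcomp (gsub_incl Y) g' =1 g.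
  move=> ij gE; have hg b : iset_set Y (g b).
    rewrite -[iset_set Y _]/(iset_set (os_filt K j)
      (set_val (g b : set_type _))) gE.
    by apply: os_incl_filt; rewrite ij ltnW.
  exists (gcorestrict hg) => //.
  rewrite (gpull_comp_ext (k := gcomp r (gcorestrict hg))) //.
  by apply: yx => // b; exact: gE.
(* The error of the extension [z] on the new base. It is divisible by each Euler class, being the
   difference of the congruence assumed for [x] and the one satisfied by the restrictions of [z]. *)
pose dx := x j - gpull (gcomp chi (orbit_zero (sob_action (os_bundle K j)))) z.
have dv (s : below j) : cdivides (euler_class eta (W s)) dx.
  have sj : (sval s < j)%N := svalP s.
  have hj : (0 < j)%N by exact: leq_ltn_trans sj.
  have his b : iset_set (os_filt K j.+1) (os_incl K (sval s) b).
    by apply: os_incl_filt; rewrite ltnS (ltnW sj) ltn_ord.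
  pose i : gmap (os_base K (sval s)) (gsub (os_filt K j.+1)) := gcorestrict his.
  have xs : gpull i z = x (sval s).
    have [//|g' <- g'i] := lower (sval s) i sj.
    by rewrite -zy; symmetry; exact: gpull_comp_ext.
  have att_i : attaches_along chi (dc_incl (D hj) s) (f s) i.
    by move=> w d w1 dw; apply: val_inj; exact: (@A2 j hj s w d w1 dw).
  have := cdividesB (Gx s) (euler_divides_restriction eta gcwB z att_i).
  by rewrite xs opprB addrA subrK.
have [z' z'Y z'x] : exists2 z' : coh E (abs (gsub (os_filt K j.+1))),
    gpull (gsub_incl Y) z' = 0 &
    gpull (gcomp chi (orbit_zero (sob_action (os_bundle K j)))) z' = dx.
  apply: (corrected_over_cell (eta := eta) gcwB att).
  have [d ->] : cdivides (cuprod (fun s : below j => euler_class eta (W s))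
      (enum (below j))) dx.
    by apply: cuprod_divides => //; [exact: A3_coprime|exact: enum_uniq].
  by have [c ->] := os_euler_divides_prod j; exists (cupr c d); rewrite cuprA.
(* On the new base [z'] supplies the error [dx]; on the earlier ones it vanishes, their inclusions
   factoring through [Y]. *)
exists (z + z') => i g; rewrite ltnS leq_eqVlt => /predU1P[ij|ij] gE.
  have ij' : i = j by exact: val_inj.
  subst i; rewrite (@gpull_ext _ _ _ _ _ g
    (gcomp chi (orbit_zero (sob_action (os_bundle K j))))).
    by rewrite gpullD z'x /dx addrC subrK.
  by move=> b; apply: val_inj; exact: gE.
have [g' g'x g'E] := lower i g ij gE.
by rewrite -!(gpull_comp_ext _ g'E) gpullD z'Y zy addr0 -g'x.
Qed.

End Stratification.

Theorem proposition2p3 (R : realType) (G : topGroupType)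
  (E : cohomology_theory R G) (co : complex_orientation E)
  (eta : thom_classes E)
  (X : gspace G) (hX : finite_gcw R X)
  (l : nat) (K : orbifold_stratification E X l)
  (W : forall (j : 'I_l) (s : below j), sob E (os_base K j))
  (D : forall j : 'I_l, (0 < j)%N -> decomposition (os_bundle K j) (W j))
  (f : forall (j : 'I_l) (s : below j),
     gmap (os_base K j) (os_base K (sval s)))
  (A2 : forall (j : 'I_l) (hj : (0 < j)%N) (s : below j),
     attaches_along (os_char K j) (dc_incl (D j hj) s) (f j s)
       (os_incl K (sval s)))
  (A3_regular : forall (j : 'I_l) (s : below j),
     nonzerodivisor (euler_class eta (W j s)))
  (A3_coprime : forall (j : 'I_l) (s t : below j), s != t ->
     relatively_prime (euler_class eta (W j s)) (euler_class eta (W j t))) :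
  range (os_restriction K) =
  [set x : forall j : 'I_l, coh E (abs (os_base K j)) |
     forall (j : 'I_l) (s : below j),
       cdivides (euler_class eta (W j s)) (x j - gpull (f j s) (x (sval s)))].
Proof.
apply/seteqP; split=> [_ [y _ <-] j s|x Gx].
  (* An index [s < j] rules out the bottom stratum, for which no decomposition is given. *)
  have hj : (0 < j)%N := leq_ltn_trans (leq0n _) (svalP s).
  exact: (@euler_divides_restriction _ _ _ eta _ _ _ _ (os_base_gcw K j)
    (D j hj) _ _ _ _ _ _ y (A2 j hj s)).
have [y yx] : exists y, restricts_to x (k := l) y.
  (* The induction starts at the empty X_0, where there is no base to match. *)
  suff : forall k, (k <= l)%N -> exists y, restricts_to x (k := k) y by exact.
  elim=> [|k IH] kl; first by exists 0 => i g; rewrite ltn0.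
  exact: (@restricts_toS _ _ _ _ _ _ eta W D f A2 A3_regular A3_coprime x Gx
    (Ordinal kl) (IH (ltnW kl))).
(* X_l is all of [X], but as a subspace; the class is moved to [X] along the corestricted
   identity. *)
have hl z : iset_set (os_filt K l) (gid X z) by rewrite os_filt_last.
exists (gpull (gcorestrict hl) y) => //.
apply: functional_extensionality_dep => i; rewrite /os_restriction.
rewrite (gpull_comp_ext (k := gcomp (gcorestrict hl) (os_incl K i))) //.
exact: yx.
Qed.
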